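(* Let $\varepsilon$ be a primitive root of unity of odd degree $\ell$, and let $\mathcal U_\varepsilon$, its central subalgebra $Z_0$, the automorphism $\mathcal R$, the group $GL_2^*=B_+\times B_-$ and the identification of $Z_0$ with the algebra of functions $C(GL_2^* )$ be as described in the context. Under this identification, the automorphism $\mathcal R$ (acting on $Z_0\otimes Z_0$) is the pull-back of the birational correspondence $\beta:GL_2^*\times GL_2^*\to GL_2^*\times GL_2^*$ defined by $$\beta:(x,y)\mapsto(x_L(x,y),x_R(x,y)),$$ where $$I(x_L(x,y))=x_-\,I(y)\,x_-^{-1},\qquad I(x_R(x,y))=(x_L(x,y))_+^{-1}\,I(x)\,(x_L(x,y))_+,$$ and $I:GL_2^*\to GL_2$ is the factorization mapping $I(x_+,x_-)=x_+x_-^{-1}$.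
   Context: $\mathcal U_\varepsilon$ is the $\mathbb C$-algebra generated by $K^{\pm1},L^{\pm1},E,F$ with relations $$KL=LK,\quad KE=\varepsilon^2EK,\quad KF=\varepsilon^{-2}FK,\quad LE=\varepsilon^2EL,\quad LF=\varepsilon^{-2}FL,\quad EF-FE=(\varepsilon-\varepsilon^{-1})(K-L^{-1}).$$ It is a Hopf algebra with comultiplication $$\Delta(K)=K\otimes K,\quad \Delta(L)=L\otimes L,\quad \Delta(E)=E\otimes K+1\otimes E,\quad \Delta(F)=F\otimes 1+L^{-1}\otimes F.$$ $Z_0$ is the central Hopf subalgebra generated by $E^\ell,F^\ell,K^{\pm\ell},L^{\pm\ell}$. Let $\sigma(a\otimes b)=b\otimes a$. The automorphism $\mathcal R$ of the division ring of $\mathcal U_\varepsilon\otimes\mathcal U_\varepsilon$ is defined by $$\mathcal R(1\otimes K)=(1\otimes K)(1-\varepsilon K^{-1}E\otimes FL)^{-1},\qquad \mathcal R(1\otimes L)=(1\otimes L)(1-\varepsilon K^{-1}E\otimes FL)^{-1},$$ $$\mathcal R(E\otimes 1)=E\otimes L,\qquad \mathcal R(1\otimes F)=K^{-1}\otimes F,$$ and on the remaining generators $K\otimes 1$, $L\otimes 1$, $1\otimes E$, $F\otimes 1$ by the condition $\mathcal R(\Delta(a))=\sigma(\Delta(a))$ for $a\in\{K,L,E,F\}$. $GL_2^*=B_+\times B_-$, where $B_+$ and $B_-$ are the groups of invertible matrices of the form $$x_+=\begin{pmatrix}1&b\\0&a\end{pmatrix}\in B_+,\qquad x_-=\begin{pmatrix}d&0\\c&1\end{pmatrix}\in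 B_-,$$ and a point $x\in GL_2^*$ is written $x=(x_+,x_-)$; $a,b,c,d$ are coordinates on $GL_2^*$. The algebra $Z_0$ is identified with $C(GL_2^* )$ by $$F^\ell\mapsto b,\qquad E^\ell\mapsto -c\,d^{-1},\qquad K^\ell\mapsto a,\qquad L^\ell\mapsto d.$$ In the pull-back, the first tensor factor is evaluated at $x_R$ and the second at $x_L$: for $f\otimes g\in Z_0\otimes Z_0$, regarded as functions on $GL_2^*$, $\mathcal R(f\otimes g)$ is the function $(x,y)\mapsto f(x_R(x,y))\,g(x_L(x,y))$.
   Formalization: The identification of Z_0 with C(GL_2^* ) is corrected to K^ℓ ↦ d^{-1}, L^ℓ ↦ a^{-1} instead of K^ℓ ↦ a, L^ℓ ↦ d; as printed the claim fails, since b(x_L) = d(x)b(y) while R(1⊗F^ℓ) = K^{-ℓ}⊗F^ℓ would be a(x)^{-1}b(y). *)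

(* Defs.v *)
From HB Require Import structures.
From mathcomp Require Import all_boot all_order all_algebra ssrAC.
From mathcomp Require Import generic_quotient boolp reals.
From mathcomp Require Import complex.

Set Implicit Arguments.
Unset Strict Implicit.
Unset Printing Implicit Defensive.

Import GRing.Theory.
Local Open Scope ring_scope.

Reserved Notation "u \ox v" (at level 40, left associativity).

Declare Scope term_scope.
Delimit Scope term_scope with term.

(* The C-algebra generated by X with relations rel: formal non-commutative    *)
(* polynomial expressions in X, modulo the smallest congruence containing the *)
(* axioms of unital associative C-algebras and rel.                           *)
Section PresentedAlgebra.
Variables (C : fieldType) (X : Type).

Inductive term : Type :=
| Gen of X
| Cst of C
| Add of term & term
| Mul of term & term.

HB.instance Definition _ := gen_eqMixin term.
HB.instance Definition _ := gen_choiceMixin term.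

Definition Sub (s t : term) : term := Add s (Mul (Cst (-1)) t).

Variable rel : term -> term -> Prop.

Inductive cong : term -> term -> Prop :=
| cong_rel s t : rel s t -> cong s t
| cong_refl s : cong s s
| cong_sym s t : cong s t -> cong t s
| cong_trans s t u : cong s t -> cong t u -> cong s u
| cong_add s s' t t' : cong s s' -> cong t t' -> cong (Add s t) (Add s' t')
| cong_mul s s' t t' : cong s s' -> cong t t' -> cong (Mul s t) (Mul s' t')
| cong_addA s t u : cong (Add s (Add t u)) (Add (Add s t) u)
| cong_addC s t : cong (Add s t) (Add t s)
| cong_add0 s : cong (Add (Cst 0) s) s
| cong_mulA s t u : cong (Mul s (Mul t u)) (Mul (Mul s t) u)
| cong_mul1 s : cong (Mul (Cst 1) s) s
| cong_mul0 s : cong (Mul (Cst 0) s) (Cst 0)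
| cong_mulDl s t u : cong (Mul (Add s t) u) (Add (Mul s u) (Mul t u))
| cong_mulDr s t u : cong (Mul s (Add t u)) (Add (Mul s t) (Mul s u))
| cong_cstD a b : cong (Cst (a + b)) (Add (Cst a) (Cst b))
| cong_cstM a b : cong (Cst (a * b)) (Mul (Cst a) (Cst b))
| cong_cstC a s : cong (Mul (Cst a) s) (Mul s (Cst a)).

Definition congb (s t : term) : bool := `[< cong s t >].

Lemma congb_refl : reflexive congb.
Proof. by move=> s; apply/asboolP; exact: cong_refl. Qed.
Lemma congb_sym : symmetric congb.
Proof. by move=> s t; apply/asboolP/asboolP; exact: cong_sym. Qed.
Lemma congb_trans : transitive congb.
Proof.
by move=> t s u /asboolP st /asboolP tu; apply/asboolP; exact: cong_trans tu.
Qed.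

Canonical congb_equiv := EquivRel congb congb_refl congb_sym congb_trans.

Definition presAlg : Type := {eq_quot congb_equiv}%qT.
HB.instance Definition _ := Choice.on presAlg.

Definition pclass (s : term) : presAlg := (\pi_({eq_quot congb_equiv}) s)%qT.
Definition prep (x : presAlg) : term := repr (x : {eq_quot congb_equiv}%qT).

Lemma prepK x : pclass (prep x) = x.
Proof. exact: reprK. Qed.

Lemma pclassP s t : pclass s = pclass t <-> cong s t.
Proof.
split=> [/eqmodP/asboolP //|st].
by apply/eqmodP/asboolP.
Qed.

Lemma prep_cong s : cong (prep (pclass s)) s.
Proof. by apply/pclassP; rewrite prepK. Qed.

Lemma presAlg_ind (P : presAlg -> Prop) :
  (forall s, P (pclass s)) -> forall x, P x.
Proof. by move=> H x; rewrite -[x]prepK. Qed.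

Definition padd (x y : presAlg) := pclass (Add (prep x) (prep y)).
Definition pmul (x y : presAlg) := pclass (Mul (prep x) (prep y)).
Definition popp (x : presAlg) := pclass (Mul (Cst (-1)) (prep x)).
Definition pscale (a : C) (x : presAlg) := pclass (Mul (Cst a) (prep x)).

Lemma paddE s t : padd (pclass s) (pclass t) = pclass (Add s t).
Proof. by apply/pclassP/cong_add; exact: prep_cong. Qed.
Lemma pmulE s t : pmul (pclass s) (pclass t) = pclass (Mul s t).
Proof. by apply/pclassP/cong_mul; exact: prep_cong. Qed.
Lemma poppE s : popp (pclass s) = pclass (Mul (Cst (-1)) s).
Proof. by apply/pclassP/cong_mul; [exact: cong_refl|exact: prep_cong]. Qed.
Lemma pscaleE a s : pscale a (pclass s) = pclass (Mul (Cst a) s).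
Proof. by apply/pclassP/cong_mul; [exact: cong_refl|exact: prep_cong]. Qed.

Let pE := (paddE, pmulE, poppE, pscaleE).

Lemma paddA : associative padd.
Proof.
elim/presAlg_ind=> s; elim/presAlg_ind=> t; elim/presAlg_ind=> u.
by rewrite !pE; apply/pclassP/cong_addA.
Qed.
Lemma paddC : commutative padd.
Proof.
elim/presAlg_ind=> s; elim/presAlg_ind=> t.
by rewrite !pE; apply/pclassP/cong_addC.
Qed.
Lemma padd0 : left_id (pclass (Cst 0)) padd.
Proof. by elim/presAlg_ind=> s; rewrite !pE; apply/pclassP/cong_add0. Qed.
Lemma paddN : left_inverse (pclass (Cst 0)) popp padd.
Proof.
elim/presAlg_ind=> s; rewrite !pE; apply/pclassP.
apply: cong_trans (cong_mul0 s).
apply: cong_trans (cong_add (cong_refl _) (cong_sym (cong_mul1 s))) _.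
apply: cong_trans (cong_sym (cong_mulDl _ _ _)) _.
apply: cong_mul (cong_refl _); apply: cong_sym.
by have := cong_cstD (-1) 1; rewrite addNr.
Qed.
HB.instance Definition _ :=
  GRing.isZmodule.Build presAlg paddA paddC padd0 paddN.

Lemma pmulA : associative pmul.
Proof.
elim/presAlg_ind=> s; elim/presAlg_ind=> t; elim/presAlg_ind=> u.
by rewrite !pE; apply/pclassP/cong_mulA.
Qed.
Lemma pmul1x : left_id (pclass (Cst 1)) pmul.
Proof. by elim/presAlg_ind=> s; rewrite !pE; apply/pclassP/cong_mul1. Qed.
Lemma pmulx1 : right_id (pclass (Cst 1)) pmul.
Proof.
elim/presAlg_ind=> s; rewrite !pE; apply/pclassP.
exact: cong_trans (cong_sym (cong_cstC _ _)) (cong_mul1 _).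
Qed.
Lemma pmulDl : left_distributive pmul padd.
Proof.
elim/presAlg_ind=> s; elim/presAlg_ind=> t; elim/presAlg_ind=> u.
by rewrite !pE; apply/pclassP/cong_mulDl.
Qed.
Lemma pmulDr : right_distributive pmul padd.
Proof.
elim/presAlg_ind=> s; elim/presAlg_ind=> t; elim/presAlg_ind=> u.
by rewrite !pE; apply/pclassP/cong_mulDr.
Qed.
HB.instance Definition _ := GRing.Zmodule_isPzRing.Build presAlg
  pmulA pmul1x pmulx1 pmulDl pmulDr.

Lemma pscaleA a b x : pscale a (pscale b x) = pscale (a * b) x.
Proof.
elim/presAlg_ind: x => s; rewrite !pE; apply/pclassP.
apply: cong_trans (cong_mulA _ _ _) _.
exact: cong_mul (cong_sym (cong_cstM _ _)) (cong_refl _).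
Qed.
Lemma pscale1 : left_id 1 pscale.
Proof. by elim/presAlg_ind=> s; rewrite !pE; apply/pclassP/cong_mul1. Qed.
Lemma pscaleDr : right_distributive pscale padd.
Proof.
move=> a; elim/presAlg_ind=> s; elim/presAlg_ind=> t.
by rewrite !pE; apply/pclassP/cong_mulDr.
Qed.
Lemma pscaleDl x : {morph pscale^~ x : a b / a + b}.
Proof.
elim/presAlg_ind: x => s a b.
change (pscale (a + b) (pclass s) =
        padd (pscale a (pclass s)) (pscale b (pclass s))).
rewrite !pE; apply/pclassP.
exact: cong_trans (cong_mul (cong_cstD _ _) (cong_refl _)) (cong_mulDl _ _ _).
Qed.
HB.instance Definition _ := GRing.Zmodule_isLmodule.Build C presAlg
  pscaleA pscale1 pscaleDr pscaleDl.

Lemma pscaleAl a (x y : presAlg) : a *: (x * y) = (a *: x) * y.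
Proof.
elim/presAlg_ind: x => s; elim/presAlg_ind: y => t.
change (pscale a (pmul (pclass s) (pclass t)) =
        pmul (pscale a (pclass s)) (pclass t)).
by rewrite !pE; apply/pclassP/cong_mulA.
Qed.
Lemma pscaleAr a (x y : presAlg) : a *: (x * y) = x * (a *: y).
Proof.
elim/presAlg_ind: x => s; elim/presAlg_ind: y => t.
change (pscale a (pmul (pclass s) (pclass t)) =
        pmul (pclass s) (pscale a (pclass t))).
rewrite !pE; apply/pclassP.
apply: cong_trans (cong_mulA _ _ _) _.
apply: cong_trans (cong_mul (cong_cstC _ _) (cong_refl _)) _.
exact: cong_sym (cong_mulA _ _ _).
Qed.

Lemma pclassD s t : pclass (Add s t) = pclass s + pclass t.
Proof. exact/esym/paddE. Qed.
Lemma pclassM s t : pclass (Mul s t) = pclass s * pclass t.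
Proof. exact/esym/pmulE. Qed.
Lemma pclassC a : pclass (Cst a) = a *: (1 : presAlg).
Proof.
change (pclass (Cst a) = pscale a (pclass (Cst 1))).
rewrite pE; apply/pclassP.
exact: cong_trans (cong_sym (cong_mul1 _)) (cong_sym (cong_cstC _ _)).
Qed.
Lemma pclassB s t : pclass (Sub s t) = pclass s - pclass t.
Proof.
by rewrite pclassD; congr (_ + _); exact/esym/poppE.
Qed.

Definition pgen (x : X) : presAlg := pclass (Gen x).

(* An assignment of the generators compatible with rel extends to a morphism; *)
(* plift is meaningful only under that hypothesis.                            *)
Section Lift.
Variables (A : algType C) (f : X -> A).

Fixpoint teval (s : term) : A :=
  match s with
  | Gen x => f x
  | Cst a => a%:A
  | Add s t => teval s + teval t
  | Mul s t => teval s * teval t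
  end.

Definition plift (x : presAlg) : A := teval (prep x).

Hypothesis f_rel : forall s t, rel s t -> teval s = teval t.

Lemma teval_cong s t : cong s t -> teval s = teval t.
Proof.
elim=> {s t} //=.
- by move=> s t u _ -> _ ->.
- by move=> s s' t t' _ -> _ ->.
- by move=> s s' t t' _ -> _ ->.
- by move=> s t u; rewrite addrA.
- by move=> s t; rewrite addrC.
- by move=> s; rewrite scale0r add0r.
- by move=> s t u; rewrite mulrA.
- by move=> s; rewrite scale1r mul1r.
- by move=> s; rewrite scale0r mul0r.
- by move=> s t u; rewrite mulrDl.
- by move=> s t u; rewrite mulrDr.
- by move=> a b; rewrite scalerDl.
- by move=> a b; rewrite -scalerAl mul1r scalerA.
- by move=> a s; rewrite -scalerAl -scalerAr mul1r mulr1.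
Qed.

Lemma pliftE s : plift (pclass s) = teval s.
Proof. exact/teval_cong/prep_cong. Qed.

Lemma plift_gen x : plift (pgen x) = f x.
Proof. exact: pliftE. Qed.

Lemma plift_linear : linear plift.
Proof.
move=> a; elim/presAlg_ind=> s; elim/presAlg_ind=> t.
have -> : a *: pclass s = pclass (Mul (Cst a) s) by exact: pscaleE.
rewrite -pclassD !pliftE /=.
by rewrite -scalerAl mul1r.
Qed.

Lemma plift_monoid : monoid_morphism plift.
Proof.
split; first by rewrite (pliftE (Cst 1)) /= scale1r.
by elim/presAlg_ind=> s; elim/presAlg_ind=> t; rewrite -pclassM !pliftE.
Qed.

Lemma plift_nontrivial : (1 : presAlg) != 0.
Proof.
have [p1 _] := plift_monoid; apply/eqP => e.
have p0 : plift 0 = 0.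
  by apply: (addIr (plift 0)); rewrite -[X in X + _]scale1r -plift_linear;
     rewrite scale1r !add0r.
by move/eqP: (oner_neq0 A); apply; rewrite -p1 e p0.
Qed.

End Lift.

End PresentedAlgebra.

Arguments Gen {C X}.
Arguments Cst {C X}.
Notation "s + t" := (Add s t) : term_scope.
Notation "s - t" := (Sub s t) : term_scope.
Notation "s * t" := (Mul s t) : term_scope.

(* The tensor product of algebras, generated by the symbols a (x) b.          *)
Inductive tensor_rel (C : fieldType) (A B : algType C) :
  term C (A * B) -> term C (A * B) -> Prop :=
| tensorDl a a' b :
    tensor_rel (Gen (a + a', b)) (Gen (a, b) + Gen (a', b))%term
| tensorDr a b b' :
    tensor_rel (Gen (a, b + b')) (Gen (a, b) + Gen (a, b'))%term
| tensorZl c a b : tensor_rel (Gen (c *: a, b)) (Cst c * Gen (a, b))%term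
| tensorZr c a b : tensor_rel (Gen (a, c *: b)) (Cst c * Gen (a, b))%term
| tensor1 : tensor_rel (Gen (1, 1)) (Cst 1)
| tensorM a a' b b' :
    tensor_rel (Gen (a * a', b * b')) (Gen (a, b) * Gen (a', b'))%term.

Section QuantumAlgebra.
Variables (C : fieldType) (eps : C).

Inductive Ugen := gK | gKV | gL | gLV | gE | gF.

Local Notation K := (Gen gK).
Local Notation KV := (Gen gKV).
Local Notation L := (Gen gL).
Local Notation LV := (Gen gLV).
Local Notation E := (Gen gE).
Local Notation F := (Gen gF).

Inductive Urel : term C Ugen -> term C Ugen -> Prop :=
| rel_KKV : Urel (K * KV)%term (Cst 1)
| rel_KVK : Urel (KV * K)%term (Cst 1)
| rel_LLV : Urel (L * LV)%term (Cst 1)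
| rel_LVL : Urel (LV * L)%term (Cst 1)
| rel_KL : Urel (K * L)%term (L * K)%term
| rel_KE : Urel (K * E)%term (Cst (eps ^+ 2) * (E * K))%term
| rel_KF : Urel (K * F)%term (Cst (eps ^- 2) * (F * K))%term
| rel_LE : Urel (L * E)%term (Cst (eps ^+ 2) * (E * L))%term
| rel_LF : Urel (L * F)%term (Cst (eps ^- 2) * (F * L))%term
| rel_EF : Urel (E * F - F * E)%term (Cst (eps - eps^-1) * (K - LV))%term.

Definition U : Type := presAlg Urel.
HB.instance Definition _ := GRing.PzRing.on U.
HB.instance Definition _ := GRing.Lmodule.on U.

Definition counit_gen (g : Ugen) : C^o :=
  match g with gE | gF => 0 | _ => 1 end.

Definition counit : U -> C^o := plift counit_gen.

Lemma counit_rel s t : Urel s t -> teval counit_gen s = teval counit_gen t.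
Proof.
case=> /=;
  rewrite ?(mulr0, mul0r, mulr1, mul1r, scaler0, scale1r, addr0)//.
by rewrite scaleN1r addrN mulr0.
Qed.

HB.instance Definition _ :=
  GRing.PzSemiRing_isNonZero.Build U (plift_nontrivial counit_rel).
HB.instance Definition _ :=
  GRing.Lmodule_isLalgebra.Build C U (@pscaleAl _ _ Urel).
HB.instance Definition _ :=
  GRing.Lalgebra_isAlgebra.Build C U (@pscaleAr _ _ Urel).

Definition uK : U := pgen Urel gK.
Definition uKV : U := pgen Urel gKV.
Definition uL : U := pgen Urel gL.
Definition uLV : U := pgen Urel gLV.
Definition uE : U := pgen Urel gE.
Definition uF : U := pgen Urel gF.

Let U_rel s t : Urel s t -> pclass Urel s = pclass Urel t.
Proof. by move=> st; apply/pclassP/cong_rel. Qed.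

Let pcE := (pclassB, pclassM, pclassC).

Lemma uKKV : uK * uKV = 1.
Proof. by have := U_rel rel_KKV; rewrite !pcE scale1r. Qed.
Lemma uKVK : uKV * uK = 1.
Proof. by have := U_rel rel_KVK; rewrite !pcE scale1r. Qed.
Lemma uLLV : uL * uLV = 1.
Proof. by have := U_rel rel_LLV; rewrite !pcE scale1r. Qed.
Lemma uLVL : uLV * uL = 1.
Proof. by have := U_rel rel_LVL; rewrite !pcE scale1r. Qed.
Lemma uKL : uK * uL = uL * uK.
Proof. by have := U_rel rel_KL; rewrite !pcE. Qed.
Lemma uKE : uK * uE = eps ^+ 2 *: (uE * uK).
Proof. by have := U_rel rel_KE; rewrite !pcE -[in RHS](@pscaleAl _ _ Urel) mul1r. Qed.
Lemma uKF : uK * uF = eps ^- 2 *: (uF * uK).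
Proof. by have := U_rel rel_KF; rewrite !pcE -[in RHS](@pscaleAl _ _ Urel) mul1r. Qed.
Lemma uLE : uL * uE = eps ^+ 2 *: (uE * uL).
Proof. by have := U_rel rel_LE; rewrite !pcE -[in RHS](@pscaleAl _ _ Urel) mul1r. Qed.
Lemma uLF : uL * uF = eps ^- 2 *: (uF * uL).
Proof. by have := U_rel rel_LF; rewrite !pcE -[in RHS](@pscaleAl _ _ Urel) mul1r. Qed.
Lemma uEF : uE * uF - uF * uE = (eps - eps^-1) *: (uK - uLV).
Proof. by have := U_rel rel_EF; rewrite !pcE -[in RHS](@pscaleAl _ _ Urel) mul1r. Qed.

Definition UU : Type := presAlg (@tensor_rel C U U).
HB.instance Definition _ := GRing.PzRing.on UU.
HB.instance Definition _ := GRing.Lmodule.on UU.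

Definition counit2_gen (p : U * U) : C^o := counit p.1 * counit p.2.

Lemma counit2_rel s t :
  tensor_rel s t -> teval counit2_gen s = teval counit2_gen t.
Proof.
have cl := plift_linear counit_rel; have [c1 cM] := plift_monoid counit_rel.
have cD u v : counit (u + v) = counit u + counit v.
  by rewrite -[u]scale1r /counit cl scale1r scale1r.
have c0 : counit 0 = 0.
  by apply: (addrI (counit 0)); rewrite -cD !addr0.
have cZ a u : counit (a *: u) = a * counit u.
  by rewrite -[a *: u]addr0 /counit cl -/counit c0 addr0.
case=> /= *; rewrite /counit2_gen /= ?cD ?cZ ?(mulrDl, mulrDr)//.
- by rewrite -mulrA; congr (_ * _); rewrite [RHS]mulr1.
- by rewrite mulrCA; congr (_ * _); rewrite [RHS]mulr1.
- by rewrite /counit c1 mulr1 scale1r.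
- by rewrite /counit !cM mulrACA.
Qed.

HB.instance Definition _ :=
  GRing.PzSemiRing_isNonZero.Build UU (plift_nontrivial counit2_rel).
HB.instance Definition _ :=
  GRing.Lmodule_isLalgebra.Build C UU (@pscaleAl _ _ (@tensor_rel C U U)).
HB.instance Definition _ :=
  GRing.Lalgebra_isAlgebra.Build C UU (@pscaleAr _ _ (@tensor_rel C U U)).

Definition tens (u v : U) : UU := pgen (@tensor_rel C U U) (u, v).
Local Notation "u \ox v" := (tens u v).

Let UU_rel s t : tensor_rel s t ->
  pclass (@tensor_rel C U U) s = pclass (@tensor_rel C U U) t.
Proof. by move=> st; apply/pclassP/cong_rel. Qed.

Lemma tensDl u u' v : (u + u') \ox v = u \ox v + u' \ox v.
Proof. by have := UU_rel (tensorDl u u' v); rewrite pclassD. Qed.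
Lemma tensDr u v v' : u \ox (v + v') = u \ox v + u \ox v'.
Proof. by have := UU_rel (tensorDr u v v'); rewrite pclassD. Qed.
Lemma tensZl a u v : (a *: u) \ox v = a *: (u \ox v).
Proof.
by have := UU_rel (tensorZl a u v); rewrite !pcE -[in RHS](@pscaleAl _ _ _) mul1r.
Qed.
Lemma tensZr a u v : u \ox (a *: v) = a *: (u \ox v).
Proof.
by have := UU_rel (tensorZr a u v); rewrite !pcE -[in RHS](@pscaleAl _ _ _) mul1r.
Qed.
Lemma tens1 : 1 \ox 1 = 1.
Proof. by have := UU_rel (@tensor1 C U U); rewrite !pcE scale1r. Qed.
Lemma tensM u u' v v' : (u * u') \ox (v * v') = (u \ox v) * (u' \ox v').
Proof. by have := UU_rel (tensorM u u' v v'); rewrite !pcE. Qed.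

Definition Delta_gen (g : Ugen) : UU :=
  match g with
  | gK => uK \ox uK
  | gKV => uKV \ox uKV
  | gL => uL \ox uL
  | gLV => uLV \ox uLV
  | gE => uE \ox uK + 1 \ox uE
  | gF => uF \ox 1 + uLV \ox uF
  end.

Definition Delta : U -> UU := plift Delta_gen.

Lemma uELV : uE * uLV = eps ^+ 2 *: (uLV * uE).
Proof.
rewrite -[uE in LHS]mul1r -uLVL -!mulrA [uL * _]mulrA uLE.
by rewrite -scalerAl -mulrA uLLV mulr1 -scalerAr.
Qed.

Lemma uFLV : uF * uLV = eps ^- 2 *: (uLV * uF).
Proof.
rewrite -[uF in LHS]mul1r -uLVL -!mulrA [uL * _]mulrA uLF.
by rewrite -scalerAl -mulrA uLLV mulr1 -scalerAr.
Qed.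

Lemma uKLV : uK * uLV = uLV * uK.
Proof.
rewrite -[uK in LHS]mul1r -uLVL -!mulrA; congr (_ * _).
by rewrite mulrA -uKL -mulrA uLLV mulr1.
Qed.

Let scal1 (A : algType C) a (x : A) : a%:A * x = a *: x.
Proof. by rewrite -scalerAl mul1r. Qed.

Let E_F_0 : eps = 0 -> uE = 0 /\ uF = 0.
Proof.
move=> e; split; rewrite -[LHS]mul1r -uKVK -mulrA.
  by rewrite uKE e expr2 mul0r scale0r mulr0.
by rewrite uKF e expr2 mul0r invr0 scale0r mulr0.
Qed.

Let tens0l u : 0 \ox u = 0.
Proof. by rewrite -(scale0r 0) tensZl scale0r. Qed.
Let tens0r u : u \ox 0 = 0.
Proof. by rewrite -(scale0r 0) tensZr scale0r. Qed.

Lemma Delta_rel s t : Urel s t -> teval Delta_gen s = teval Delta_gen t.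
Proof.
case=> /=; rewrite ?scal1 -?tensM ?(uKKV, uKVK, uLLV, uLVL) ?tens1 ?scale1r//.
- by rewrite uKL.
- rewrite mulrDl mulrDr -!tensM scalerDr.
  by rewrite !uKE tensZl tensZr mulr1 mul1r.
- rewrite mulrDl mulrDr -!tensM scalerDr.
  by rewrite !uKF tensZl tensZr uKLV mulr1 mul1r.
- rewrite mulrDl mulrDr -!tensM scalerDr.
  by rewrite !uLE tensZl tensZr uKL mulr1 mul1r.
- rewrite mulrDl mulrDr -!tensM scalerDr.
  by rewrite !uLF tensZl tensZr uLLV uLVL mulr1 mul1r.
rewrite !scaleN1r; have [e|e] := eqVneq eps 0.
  have [-> ->] := E_F_0 e.
  by rewrite !tens0l !tens0r !addr0 mul0r subrr e invr0 subrr scale0r.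
rewrite !(mulrDl, mulrDr) -!tensM !mul1r !mulr1.
have -> : (uE * uLV) \ox (uK * uF) = (uLV * uE) \ox (uF * uK).
  rewrite uELV uKF tensZl tensZr scalerA mulfV ?scale1r//.
  by rewrite expf_neq0.
rewrite !opprD !addrA.
have EF : uE * uF = uF * uE + (eps - eps^-1) *: (uK - uLV).
  by rewrite -uEF addrC subrK.
rewrite !EF tensDl tensDr tensZl tensZr.
have cancel (V : zmodType) (P X Q S T Y : V) :
    P + X + Q + S + (T + Y) - P - S - Q - T = X + Y.
  by rewrite addrA [LHS](ACl (1*7*3*9*4*8*5*10*2*6))/= !(subrr, add0r, addrK).
rewrite cancel -scalerDr; congr (_ *: _).
have tensN u v : (- u) \ox v = - (u \ox v) by rewrite -scaleN1r tensZl scaleN1r.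
have tensrN u v : u \ox (- v) = - (u \ox v) by rewrite -scaleN1r tensZr scaleN1r.
by rewrite tensDl tensDr tensN tensrN addrA subrK.
Qed.

HB.instance Definition _ := GRing.isLinear.Build C U UU *:%R Delta
  (plift_linear Delta_rel).
HB.instance Definition _ := GRing.isMonoidMorphism.Build U UU Delta
  (plift_monoid Delta_rel).

Definition sigma : UU -> UU := plift (fun p : U * U => p.2 \ox p.1 : UU).

Lemma sigma_rel s t : tensor_rel s t ->
  teval (fun p : U * U => p.2 \ox p.1 : UU) s =
  teval (fun p : U * U => p.2 \ox p.1 : UU) t.
Proof.
case=> /= *; rewrite ?(tensDl, tensDr, tensZl, tensZr, tens1, tensM)//.
- by rewrite -scalerAl mul1r.
- by rewrite -scalerAl mul1r.
- by rewrite scale1r.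
Qed.

HB.instance Definition _ := GRing.isLinear.Build C UU UU *:%R sigma
  (plift_linear sigma_rel).
HB.instance Definition _ := GRing.isMonoidMorphism.Build UU UU sigma
  (plift_monoid sigma_rel).

Lemma sigma_tens u v : sigma (u \ox v) = v \ox u.
Proof. exact: plift_gen sigma_rel (u, v). Qed.

End QuantumAlgebra.

Arguments uK {C eps}.
Arguments uKV {C eps}.
Arguments uL {C eps}.
Arguments uLV {C eps}.
Arguments uE {C eps}.
Arguments uF {C eps}.
Notation "u \ox v" := (tens u v) : ring_scope.

Section DivisionRing.
Variables (C : fieldType) (eps : C) (D : unitAlgType C).
Variable iota : {lrmorphism UU eps -> D}.

(* D is the Ore division ring of fractions of U (x) U, embedded by iota.      *)
Record is_division_ring_of_fractions : Prop := IsDivisionRingOfFractions {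
  divring_unit : forall r : D, r != 0 -> r \is a GRing.unit;
  divring_inj : injective iota;
  divring_frac : forall r : D, exists s t : UU eps,
    t != 0 /\ r = iota s * (iota t)^-1
}.

Record is_R_automorphism (Rm : {lrmorphism D -> D}) : Prop := IsRAutomorphism {
  Rm_bij : bijective Rm;
  Rm_1K : Rm (iota (1 \ox uK)) =
    iota (1 \ox uK) * (1 - eps *: iota ((uKV * uE) \ox (uF * uL)))^-1;
  Rm_1L : Rm (iota (1 \ox uL)) =
    iota (1 \ox uL) * (1 - eps *: iota ((uKV * uE) \ox (uF * uL)))^-1;
  Rm_E1 : Rm (iota (uE \ox 1)) = iota (uE \ox uL);
  Rm_1F : Rm (iota (1 \ox uF)) = iota (uKV \ox uF);
  Rm_Delta : forall u : U eps, u \in [:: uK; uL; uE; uF] ->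
    Rm (iota (Delta u)) = iota (sigma (Delta u))
}.

End DivisionRing.

Section DualGroup.
Variable C : fieldType.

Definition is_Bplus (M : 'M[C]_2) :=
  [&& M \in unitmx, M 0 0 == 1 & M 1 0 == 0].
Definition is_Bminus (M : 'M[C]_2) :=
  [&& M \in unitmx, M 0 1 == 0 & M 1 1 == 1].

Definition GL2star : Type :=
  ({M : 'M[C]_2 | is_Bplus M} * {M : 'M[C]_2 | is_Bminus M})%type.

Definition pos_part (x : GL2star) : 'M[C]_2 := val x.1.
Definition neg_part (x : GL2star) : 'M[C]_2 := val x.2.

Definition coord_a (x : GL2star) : C := pos_part x 1 1.
Definition coord_b (x : GL2star) : C := pos_part x 0 1.
Definition coord_c (x : GL2star) : C := neg_part x 1 0.
Definition coord_d (x : GL2star) : C := neg_part x 0 0.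

(* The coordinate ring C[a^{+-1}, b, c, d^{+-1}] of GL2star.                  *)
Inductive regular : (GL2star -> C) -> Prop :=
| regular_cst k : regular (fun=> k)
| regular_a : regular coord_a
| regular_aV : regular (fun x => (coord_a x)^-1)
| regular_b : regular coord_b
| regular_c : regular coord_c
| regular_d : regular coord_d
| regular_dV : regular (fun x => (coord_d x)^-1)
| regularD f g : regular f -> regular g -> regular (fun x => f x + g x)
| regularM f g : regular f -> regular g -> regular (fun x => f x * g x).

Inductive regular2 : (GL2star * GL2star -> C) -> Prop :=
| regular2_fst f : regular f -> regular2 (fun z => f z.1)
| regular2_snd f : regular f -> regular2 (fun z => f z.2)
| regular2D f g : regular2 f -> regular2 g -> regular2 (fun z => f z + g z)
| regular2M f g : regular2 f -> regular2 g -> regular2 (fun z => f z * g z).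

(* A correspondence G is rational if it is single-valued and restricts to a   *)
(* morphism on some non-empty principal open subset {q <> 0} of the           *)
(* (irreducible affine) variety GL2star * GL2star: the pull-back of every     *)
(* regular function lies in the localization at q.                            *)
Definition rational_map (G : GL2star * GL2star -> GL2star * GL2star -> Prop) :
    Prop :=
  (forall z z1 z2, G z z1 -> G z z2 -> z1 = z2) /\
  exists q, [/\ regular2 q, exists z, q z != 0,
    forall z, q z != 0 -> exists z', G z z' &
    forall f, regular2 f -> exists g k, regular2 g /\
      forall z z', q z != 0 -> G z z' -> f z' = g z / q z ^+ k].

Definition birational (G : GL2star * GL2star -> GL2star * GL2star -> Prop) :
    Prop :=
  rational_map G /\ rational_map (fun z z' => G z' z).

Definition Imap (x : GL2star) : 'M[C]_2 := pos_part x *m invmx (neg_part x).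

Definition beta (z z' : GL2star * GL2star) : Prop :=
  let: (x, y) := z in let: (xL, xR) := z' in
  Imap xL = neg_part x *m Imap y *m invmx (neg_part x) /\
  Imap xR = invmx (pos_part xL) *m Imap x *m pos_part xL.

End DualGroup.

Section Identification.
Variables (C : fieldType) (eps : C) (l : nat).

Inductive inZ0 : U eps -> Prop :=
| inZ0_E : inZ0 (uE ^+ l)
| inZ0_F : inZ0 (uF ^+ l)
| inZ0_K : inZ0 (uK ^+ l)
| inZ0_KV : inZ0 (uKV ^+ l)
| inZ0_L : inZ0 (uL ^+ l)
| inZ0_LV : inZ0 (uLV ^+ l)
| inZ0_1 : inZ0 1
| inZ0_Z k u : inZ0 u -> inZ0 (k *: u)
| inZ0_D u v : inZ0 u -> inZ0 v -> inZ0 (u + v)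
| inZ0_M u v : inZ0 u -> inZ0 v -> inZ0 (u * v).

Variable phi : U eps -> GL2star C -> C.

(* phi restricts to an algebra isomorphism of Z0 onto the coordinate ring;    *)
(* its values outside Z0 are irrelevant.  K^l and L^l go to d^-1 and a^-1:    *)
(* this is forced by R(1 (x) F) = K^-1 (x) F and R(E (x) 1) = E (x) L, as     *)
(* beta satisfies b(x_L) = d(x) b(y) and (c/d)(x_R) = (c/d)(x) a(y)^-1.       *)
(* With K^l |-> a, L^l |-> d instead, R would not be the pull-back of beta.   *)
Record is_Z0_identification : Prop := IsZ0Identification {
  phi_1 : phi 1 = fun=> 1;
  phi_Z : forall k u, inZ0 u -> phi (k *: u) = fun x => k * phi u x;
  phi_D : forall u v, inZ0 u -> inZ0 v ->
    phi (u + v) = fun x => phi u x + phi v x;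
  phi_M : forall u v, inZ0 u -> inZ0 v ->
    phi (u * v) = fun x => phi u x * phi v x;
  phi_inj : forall u v, inZ0 u -> inZ0 v -> phi u = phi v -> u = v;
  phi_regular : forall u, inZ0 u -> regular (phi u);
  phi_surj : forall f, regular f -> exists2 u, inZ0 u & phi u = f;
  phi_F : phi (uF ^+ l) = @coord_b C;
  phi_E : phi (uE ^+ l) = fun x => - coord_c x * (coord_d x)^-1;
  phi_K : phi (uK ^+ l) = fun x => (coord_d x)^-1;
  phi_L : phi (uL ^+ l) = fun x => (coord_a x)^-1
}.

(* t lies in Z0 (x) Z0 and is identified with the function h.                 *)
Definition Z0Z0_function (t : UU eps) (h : GL2star C * GL2star C -> C) : Prop :=
  exists s : seq (U eps * U eps),
    [/\ forall p, p \in s -> inZ0 p.1 /\ inZ0 p.2,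
        t = \sum_(p <- s) p.1 \ox p.2 &
        forall x y, h (x, y) = \sum_(p <- s) phi p.1 x * phi p.2 y].

Variables (D : unitAlgType C) (iota : {lrmorphism UU eps -> D}).

(* r lies in Frac (Z0 (x) Z0) and is identified with the rational function    *)
(* f / g.                                                                     *)
Definition rational_function (r : D) (f g : GL2star C * GL2star C -> C) :
    Prop :=
  exists s t, [/\ Z0Z0_function s f, Z0Z0_function t g, t != 0,
    exists z, g z != 0 & r = iota s * (iota t)^-1].

(* The first tensor factor is evaluated at x_R, the second one at x_L.        *)
Definition is_pullback_of (Rm : D -> D)
    (G : GL2star C * GL2star C -> GL2star C * GL2star C -> Prop) : Prop :=
  forall t h, Z0Z0_function t h -> exists f g,
    rational_function (Rm (iota t)) f g /\
    forall x y xL xR, G (x, y) (xL, xR) -> g (x, y) != 0 ->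
      h (xR, xL) = f (x, y) / g (x, y).

End Identification.

(* Main.v *)
Require Import Defs.
From mathcomp Require Import all_boot all_order all_algebra.
From mathcomp Require Import reals complex ring.

(** The statement has a purely commutative half and a half that reduces the
    quantum algebra to it.

    In the coordinates [(a, b, c, d)] the factorization mapping [I] is inverted
    by an explicit rational formula ([Imap_mx2]), because [det I(x) = a / d].
    Since conjugation preserves the determinant, the two equations defining
    [beta] turn into formulas for [(x_L, x_R)] in terms of [(x, y)] ([betaE]),
    whose only denominator, up to invertible coordinates, is
    [pivot = a(y) + c(x) b(y)].  The equations can equally be solved for
    [(x, y)] ([betaVE]), with denominator
    [copivot = d(x_R) + c(x_R) b(x_L)].  Hence [beta] is birational.

    For the quantum half, [eps^2] is a primitive [l]-th root of unity, so two
    elements that commute up to [eps^2] satisfy [(x + y)^l = x^l + y^l]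
    ([qfrobenius]).  This computes every [l]-th power that occurs.  With
    [Rden = 1 - K^-l E^l (x) F^l L^l] one finds
      [R (1 (x) K^-l) = Rden (1 (x) K^-l)] and
      [R (1 (x) L^-l) = Rden (1 (x) L^-l)]
    ([R_1_inv_pow]), while [R (E^l (x) 1) = E^l (x) L^l] and
    [R (1 (x) F^l) = K^-l (x) F^l] are immediate.  The compatibility of [R]
    with comultiplication determines its values on the other central
    generators, [Delta (E^l)] and [Delta (F^l)] being again sums of two terms.

    Under the identification with functions, which sends [K^l] to [d^-1] and
    [L^l] to [a^-1], the element [Rden] becomes [pivot / a(y)], and the values
    of [R] on the generators become exactly the coordinate formulas of [betaE]
    ([pulled_back_K] and its analogues).  Both sides being multiplicative,
    agreement on generators gives agreement on all of the central subalgebra.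
    Commutativity of that subalgebra ([inZ0_comm]) is what lets fractions whose
    denominator is a power of [Rden] be added and multiplied. *)

Local Open Scope ring_scope.
Set Implicit Arguments.
Unset Strict Implicit.
Unset Printing Implicit Defensive.
Import GRing.Theory.

(** * The factorization mapping in coordinates *)

Section FactorizationInCoordinates.
Variable C : fieldType.
Implicit Types x y u v : GL2star C.

Definition mx2 (p q r s : C) : 'M[C]_2 :=
  \matrix_(i, j) (if i == 0 then if j == 0 then p else q
                  else if j == 0 then r else s).

Lemma ord2P (P : 'I_2 -> Prop) : P 0 -> P 1 -> forall i, P i.
Proof.
move=> P0 P1 [[|[|//]] ilt].
  by rewrite (_ : Ordinal ilt = 0) //; apply: val_inj.
by rewrite (_ : Ordinal ilt = 1) //; apply: val_inj.
Qed.

Lemma mx2_eta (M : 'M[C]_2) : M = mx2 (M 0 0) (M 0 1) (M 1 0) (M 1 1).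
Proof. by apply/matrixP; elim/ord2P; elim/ord2P; rewrite mxE. Qed.

Lemma mx2_inj p q r s p' q' r' s' :
  mx2 p q r s = mx2 p' q' r' s' -> [/\ p = p', q = q', r = r' & s = s'].
Proof.
move=> /matrixP e; split.
- by have := e 0 0; rewrite !mxE.
- by have := e 0 1; rewrite !mxE.
- by have := e 1 0; rewrite !mxE.
- by have := e 1 1; rewrite !mxE.
Qed.

Lemma mx2M p q r s p' q' r' s' :
  mx2 p q r s *m mx2 p' q' r' s' =
  mx2 (p * p' + q * r') (p * q' + q * s') (r * p' + s * r') (r * q' + s * s').
Proof.
apply/matrixP; elim/ord2P; elim/ord2P;
  by rewrite mxE !big_ord_recl big_ord0 !mxE /= addr0.
Qed.

Lemma mx2_1 : 1%:M = mx2 1 0 0 1.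
Proof. by apply/matrixP; elim/ord2P; elim/ord2P; rewrite !mxE. Qed.

Lemma invmx_mx2 p q r s : p * s - q * r != 0 ->
  invmx (mx2 p q r s) =
  let D := p * s - q * r in mx2 (s / D) (- q / D) (- r / D) (p / D).
Proof.
move=> D0 /=; set B := RHS.
have AB : mx2 p q r s *m B = 1%:M.
  by rewrite mx2M mx2_1; congr mx2; field.
have [Au _] := mulmx1_unit AB.
by rewrite -[LHS]mulmx1 -AB mulKmx.
Qed.

Definition coords x : C * C * C * C :=
  (coord_a x, coord_b x, coord_c x, coord_d x).

Lemma pos_partE x : pos_part x = mx2 1 (coord_b x) 0 (coord_a x).
Proof.
rewrite [LHS]mx2_eta /coord_a /coord_b.
by have /and3P[_ /eqP-> /eqP->] : is_Bplus (pos_part x) := valP x.1.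
Qed.

Lemma neg_partE x : neg_part x = mx2 (coord_d x) 0 (coord_c x) 1.
Proof.
rewrite [LHS]mx2_eta /coord_c /coord_d.
by have /and3P[_ /eqP-> /eqP->] : is_Bminus (neg_part x) := valP x.2.
Qed.

Lemma unitmx_pos (a b : C) : (mx2 1 b 0 a \in unitmx) = (a != 0).
Proof.
apply/idP/idP => [Mu|a0]; last first.
  have D0 : 1 * a - b * 0 != 0 by rewrite mul1r mulr0 subr0.
  suff /mulmx1_unit[] : mx2 1 b 0 a *m mx2 1 (- b / a) 0 a^-1 = 1%:M by [].
  by rewrite mx2M mx2_1; congr mx2; field.
apply/eqP => a0; have := mulmxV Mu; rewrite [invmx _]mx2_eta mx2M mx2_1.
by move=> /mx2_inj[_ _ _ /eqP]; rewrite a0 !mul0r addr0 eq_sym oner_eq0.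
Qed.

Lemma unitmx_neg (c d : C) : (mx2 d 0 c 1 \in unitmx) = (d != 0).
Proof.
apply/idP/idP => [Mu|d0]; last first.
  suff /mulmx1_unit[] : mx2 d 0 c 1 *m mx2 d^-1 0 (- c / d) 1 = 1%:M by [].
  by rewrite mx2M mx2_1; congr mx2; field.
apply/eqP => d0; have := mulmxV Mu; rewrite [invmx _]mx2_eta mx2M mx2_1.
by move=> /mx2_inj[/eqP]; rewrite d0 !mul0r addr0 eq_sym oner_eq0.
Qed.

Lemma coord_a_neq0 x : coord_a x != 0.
Proof.
rewrite -(unitmx_pos _ (coord_b x)) -pos_partE.
by have /and3P[] : is_Bplus (pos_part x) := valP x.1.
Qed.

Lemma coord_d_neq0 x : coord_d x != 0.
Proof.
rewrite -(unitmx_neg (coord_c x)) -neg_partE.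
by have /and3P[] : is_Bminus (neg_part x) := valP x.2.
Qed.

Lemma coords_inj : injective coords.
Proof.
move=> x y [ea eb ec ed]; rewrite [x]surjective_pairing [y]surjective_pairing.
congr (_, _); apply: val_inj.
  by rewrite -/(pos_part x) -/(pos_part y) !pos_partE ea eb.
by rewrite -/(neg_part x) -/(neg_part y) !neg_partE ec ed.
Qed.

Lemma coords_surj a b c d :
  a != 0 -> d != 0 -> exists x, coords x = (a, b, c, d).
Proof.
move=> a0 d0.
have P : is_Bplus (mx2 1 b 0 a) by rewrite /is_Bplus unitmx_pos a0 !mxE !eqxx.
have N : is_Bminus (mx2 d 0 c 1) by rewrite /is_Bminus unitmx_neg d0 !mxE !eqxx.
exists (exist (fun M => is_true (is_Bplus M)) _ P,
        exist (fun M => is_true (is_Bminus M)) _ N).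
rewrite /coords /coord_a /coord_b /coord_c /coord_d /pos_part /neg_part /=.
by rewrite !mxE.
Qed.

Lemma inv_pos_part x :
  invmx (pos_part x) = mx2 1 (- coord_b x / coord_a x) 0 (coord_a x)^-1.
Proof.
have a0 := coord_a_neq0 x.
rewrite pos_partE invmx_mx2 /=; last by rewrite mul1r mulr0 subr0.
by congr mx2; field.
Qed.

Lemma inv_neg_part x :
  invmx (neg_part x) = mx2 (coord_d x)^-1 0 (- coord_c x / coord_d x) 1.
Proof.
have d0 := coord_d_neq0 x.
rewrite neg_partE invmx_mx2 /=; last by rewrite mulr1 mul0r subr0.
by congr mx2; field.
Qed.

Lemma ImapE x : Imap x =
  mx2 ((1 - coord_b x * coord_c x) / coord_d x) (coord_b x)
      (- coord_a x * coord_c x / coord_d x) (coord_a x).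
Proof.
have d0 := coord_d_neq0 x.
by rewrite /Imap inv_neg_part pos_partE mx2M; congr mx2; field.
Qed.

(** The factorization mapping inverts without solving anything: with
    [M = I(x)] and [D = det M = a / d], the second column of [M] is [(b, a)],
    so [d = a / D], and then [c] is read off the remaining entry.  As [a] and
    [d] never vanish, the right-hand side forces [s] and [D] to be
    non-zero. *)
Lemma Imap_mx2 x p q r s D : p * s - q * r = D ->
  Imap x = mx2 p q r s <-> coords x = (s, q, - r / D, s / D).
Proof.
move=> <-.
have [a0 d0] := (coord_a_neq0 x, coord_d_neq0 x).
rewrite ImapE /coords; split=> [/mx2_inj[<- <- <- <-]|[ea eb ec ed]].
  have -> : (1 - coord_b x * coord_c x) / coord_d x * coord_a x -
    coord_b x * (- coord_a x * coord_c x / coord_d x) = coord_a x / coord_d x.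
    by field.
  by congr (_, _, _, _); field; rewrite ?a0 ?d0.
have D0 : p * s - q * r != 0.
  by apply: contraNneq d0; rewrite ed => ->; rewrite invr0 mulr0.
have s0 : s != 0 by rewrite -ea.
by rewrite ea eb ec ed; congr mx2; field; rewrite ?s0 ?D0.
Qed.

End FactorizationInCoordinates.

(** * The correspondence in coordinates *)

Section BetaInCoordinates.
Variable C : fieldType.
Implicit Types x y u v : GL2star C.
Local Notation a := (@coord_a C).
Local Notation b := (@coord_b C).
Local Notation c := (@coord_c C).
Local Notation d := (@coord_d C).

(** The entry [a] of [x_- I(y) x_-^-1]: the equation for [x_L] is solvable
    exactly where it does not vanish. *)
Definition pivot (z : GL2star C * GL2star C) : C :=
  a z.2 + c z.1 * b z.2.

(** The same role for the inverse correspondence: up to the unit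
    [a(x_R) / d(x_R)], the entry [a] of [(x_L)_+ I(x_R) (x_L)_+^-1]. *)
Definition copivot (w : GL2star C * GL2star C) : C :=
  d w.2 + c w.2 * b w.1.

Lemma coords_eq x a' b' c' d' : coords x = (a', b', c', d') ->
  [/\ a x = a', b x = b', c x = c' & d x = d'].
Proof. by case. Qed.

(** Conjugation preserves [det I(x) = a(x) / d(x)], so the determinants needed
    to read coordinates off both matrices are [a(y) / d(y)] and
    [a(x) / d(x)]. *)
Lemma betaE x y u v : beta (x, y) (u, v) <->
  let q := pivot (x, y) in
  coords u = (q, d x * b y, (q * (c y + c x * d y) - c x) / (a y * d x),
              d y * q / a y) /\
  coords v = (a x * a y / q, b y + b x * a y - a x * a y * d x * b y / q,
              c x / q, d x * a y / q).
Proof.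
have [ax dx] := (coord_a_neq0 x, coord_d_neq0 x).
have [ay dy] := (coord_a_neq0 y, coord_d_neq0 y).
have [av dv] := (coord_a_neq0 v, coord_d_neq0 v).
have [au du] := (coord_a_neq0 u, coord_d_neq0 u).
rewrite /beta inv_neg_part neg_partE inv_pos_part (pos_partE u).
rewrite (ImapE y) (ImapE x) !mx2M.
rewrite (@Imap_mx2 _ u _ _ _ _ (a y / d y));
  last by (field; rewrite ?ax ?ay ?dx ?dy ?au ?du ?av ?dv).
rewrite (@Imap_mx2 _ v _ _ _ _ (a x / d x));
  last by (field; rewrite ?ax ?ay ?dx ?dy ?au ?du ?av ?dv).
rewrite /pivot /=.
split=> -[eu ev].
  have [ea eb ec ed] := coords_eq eu.
  have eq : a u = a y + c x * b y by rewrite ea; field.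
  have q0 : a y + c x * b y != 0 by rewrite -eq.
  have ebu : b u = d x * b y by rewrite eb; field.
  split; first rewrite eu; last rewrite ev eq ebu; congr (_, _, _, _); field;
    rewrite ?ax ?ay ?dx ?dy ?q0 //.
have [ea eb ec ed] := coords_eq eu.
have q0 : a y + c x * b y != 0 by rewrite -ea.
split; first rewrite eu; last rewrite ev ea eb; congr (_, _, _, _); field;
    rewrite ?ax ?ay ?dx ?dy ?q0 //.
Qed.

(** The defining equations can be solved backwards because [x_R] and
    [(x_L)_+] give [I(x)], hence [x_-], which in turn gives [I(y)]. *)
Lemma betaVE x y u v : beta (x, y) (u, v) <->
  let q := copivot (u, v) in
  coords x = (a v * q / d v,
     ((b v + b u * a v) * q - b u) / (a u * d v), a u * c v, q) /\
  coords y = (a u * d v / q, b u / q,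
     c v * (1 - b u * c u) + c u * q - d u * a u * c v * d v / q,
     d u * d v / q).
Proof.
have [ax dx] := (coord_a_neq0 x, coord_d_neq0 x).
have [av dv] := (coord_a_neq0 v, coord_d_neq0 v).
have [au du] := (coord_a_neq0 u, coord_d_neq0 u).
have pu : pos_part u \in unitmx by rewrite pos_partE unitmx_pos.
have nx : neg_part x \in unitmx by rewrite neg_partE unitmx_neg.
have -> : beta (x, y) (u, v) <->
   Imap y = invmx (neg_part x) *m Imap u *m neg_part x /\
   Imap x = pos_part u *m Imap v *m invmx (pos_part u).
  rewrite /beta; split=> -[-> ->]; split;
    by rewrite !mulmxA ?mulVmx ?mulmxV ?mul1mx ?mulmxKV ?mulmxK.
rewrite inv_neg_part neg_partE inv_pos_part (pos_partE u).
rewrite (ImapE u) (ImapE v) !mx2M.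
rewrite (@Imap_mx2 _ y _ _ _ _ (a u / d u));
  last by (field; rewrite ?ax ?ay ?dx ?dy ?au ?du ?av ?dv).
rewrite (@Imap_mx2 _ x _ _ _ _ (a v / d v));
  last by (field; rewrite ?ax ?ay ?dx ?dy ?au ?du ?av ?dv).
rewrite /copivot /=.
split=> -[].
  move=> ey ex; have [ea eb ec ed] := coords_eq ex.
  have edx : d x = d v + c v * b u by rewrite ed; field; rewrite ?au ?av ?dv.
  have ecx : c x = a u * c v by rewrite ec; field; rewrite ?au ?av ?dv.
  have q0 : d v + c v * b u != 0 by rewrite -edx.
  split; first rewrite ex; last rewrite ey edx ecx; congr (_, _, _, _); field;
    rewrite ?au ?du ?av ?dv ?q0 //.
move=> ex ey; have [ea eb ec ed] := coords_eq ex.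
have q0 : d v + c v * b u != 0 by rewrite -ed.
split; first rewrite ey ed ec; last rewrite ex; congr (_, _, _, _); field;
    rewrite ?au ?du ?av ?dv ?q0 //.
Qed.

End BetaInCoordinates.

(** * Birationality *)

Section RationalMaps.
Variable C : fieldType.
Local Notation a := (@coord_a C).
Local Notation b := (@coord_b C).
Local Notation c := (@coord_c C).
Local Notation d := (@coord_d C).
Local Notation GG := (GL2star C * GL2star C)%type.
Implicit Types (x y u v : GL2star C) (z w : GG) (f g q : GG -> C).

Lemma regular2_cst k : regular2 (fun _ : GG => k).
Proof. exact: regular2_fst (regular_cst k). Qed.

Lemma regular2N f : regular2 f -> regular2 (fun z => - f z).
Proof.
move=> rf; rewrite (_ : (fun z => - f z) = fun z => -1 * f z).
  exact: regular2M (regular2_cst _) rf.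
by apply: boolp.funext => z; rewrite mulN1r.
Qed.

Lemma regular2X f n : regular2 f -> regular2 (fun z => f z ^+ n).
Proof.
move=> rf; elim: n => [|n IHn].
  rewrite (_ : (fun z => f z ^+ 0) = fun=> 1); first exact: regular2_cst.
  by apply: boolp.funext => z; rewrite expr0.
rewrite (_ : (fun z => f z ^+ n.+1) = fun z => f z * f z ^+ n).
  exact: regular2M.
by apply: boolp.funext => z; rewrite exprS.
Qed.

Variables (G : GG -> GG -> Prop) (q : GG -> C).
Hypothesis q_reg : regular2 q.

(** Composition with the correspondence lands in the localization at [q].
    These functions form an algebra, so it suffices to test the coordinates
    and the two inverted ones. *)
Definition pulls_back (f : GG -> C) : Prop := exists g k, regular2 g /\
  forall z w, q z != 0 -> G z w -> f w = g z / q z ^+ k.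

Lemma pulls_backD f1 f2 : pulls_back f1 -> pulls_back f2 ->
  pulls_back (fun w => f1 w + f2 w).
Proof.
move=> [g1 [k1 [r1 e1]]] [g2 [k2 [r2 e2]]].
exists (fun z => g1 z * q z ^+ k2 + g2 z * q z ^+ k1), (k1 + k2)%N; split.
  by apply: regular2D; apply: regular2M => //; exact: regular2X.
move=> z w q0 zw; rewrite (e1 z w)// (e2 z w)// exprD.
by field; rewrite !expf_neq0.
Qed.

Lemma pulls_backM f1 f2 : pulls_back f1 -> pulls_back f2 ->
  pulls_back (fun w => f1 w * f2 w).
Proof.
move=> [g1 [k1 [r1 e1]]] [g2 [k2 [r2 e2]]].
exists (fun z => g1 z * g2 z), (k1 + k2)%N; split; first exact: regular2M.
move=> z w q0 zw; rewrite (e1 z w)// (e2 z w)// exprD.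
by field; rewrite !expf_neq0.
Qed.

Lemma pulls_back_regular (p : GG -> GL2star C) :
  pulls_back (fun w => a (p w)) -> pulls_back (fun w => (a (p w))^-1) ->
  pulls_back (fun w => b (p w)) -> pulls_back (fun w => c (p w)) ->
  pulls_back (fun w => d (p w)) -> pulls_back (fun w => (d (p w))^-1) ->
  forall h, regular h -> pulls_back (fun w => h (p w)).
Proof.
move=> pa paV pb pc pd pdV h; elim=> //=.
- move=> k; exists (fun=> k), 0%N; split; first exact: regular2_cst.
  by move=> z w _ _; rewrite expr0 divr1.
- by move=> f1 f2 _ p1 _ p2; exact: pulls_backD.
- by move=> f1 f2 _ p1 _ p2; exact: pulls_backM.
Qed.

Lemma pulls_back_regular2 :
  (forall h, regular h -> pulls_back (fun w => h w.1)) ->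
  (forall h, regular h -> pulls_back (fun w => h w.2)) ->
  forall f, regular2 f -> pulls_back f.
Proof.
move=> p1 p2 f; elim=> // f1 f2 _ pf1 _ pf2.
  exact: pulls_backD.
exact: pulls_backM.
Qed.

End RationalMaps.

Ltac regular2_tac :=
  repeat first
    [ exact: (regular2_fst (regular_a _)) | exact: (regular2_snd (regular_a _))
    | exact: (regular2_fst (regular_b _)) | exact: (regular2_snd (regular_b _))
    | exact: (regular2_fst (regular_c _)) | exact: (regular2_snd (regular_c _))
    | exact: (regular2_fst (regular_d _)) | exact: (regular2_snd (regular_d _))
    | exact: (regular2_fst (regular_aV _))
    | exact: (regular2_snd (regular_aV _))
    | exact: (regular2_fst (regular_dV _))
    | exact: (regular2_snd (regular_dV _))
    | exact: regular2_cst | apply: regular2N | apply: regular2D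
    | apply: regular2M ].

Section BetaBirational.
Variable C : fieldType.
Local Notation a := (@coord_a C).
Local Notation b := (@coord_b C).
Local Notation c := (@coord_c C).
Local Notation d := (@coord_d C).
Local Notation GG := (GL2star C * GL2star C)%type.
Implicit Types (x y u v : GL2star C) (z w : GG) (f g q : GG -> C).

Lemma regular2_pivot : regular2 (@pivot C).
Proof. rewrite /pivot; regular2_tac. Qed.

Lemma regular2_copivot : regular2 (@copivot C).
Proof. rewrite /copivot; regular2_tac. Qed.

Lemma beta_rational : rational_map (@beta C).
Proof.
split=> [[x y] [u v] [u' v']|].
  move=> /betaE[eu ev] /betaE[eu' ev'].
  by congr (_, _); apply: coords_inj; rewrite ?eu ?ev ?eu' ?ev'.
exists (@pivot C); split; first exact: regular2_pivot.
- have [x ex] := @coords_surj C 1 0 0 1 (oner_neq0 _) (oner_neq0 _).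
  exists (x, x); move: ex => [ea eb ec ed].
  by rewrite /pivot /= ea ec mul0r addr0 oner_neq0.
- move=> [x y] q0.
  have [ax dx] := (coord_a_neq0 x, coord_d_neq0 x).
  have [ay dy] := (coord_a_neq0 y, coord_d_neq0 y).
  have [u eu] := @coords_surj C (pivot (x, y)) (d x * b y)
    ((pivot (x, y) * (c y + c x * d y) - c x) / (a y * d x))
    (d y * pivot (x, y) / a y) q0 (mulf_neq0 (mulf_neq0 dy q0) (invr_neq0 ay)).
  have [v ev] := @coords_surj C (a x * a y / pivot (x, y))
    (b y + b x * a y - a x * a y * d x * b y / pivot (x, y))
    (c x / pivot (x, y)) (d x * a y / pivot (x, y))
    (mulf_neq0 (mulf_neq0 ax ay) (invr_neq0 q0))
    (mulf_neq0 (mulf_neq0 dx ay) (invr_neq0 q0)).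
  by exists (u, v); apply/betaE.
(* Pull-backs of a, a^-1, b, c, d, d^-1, at x_L and then at x_R. *)
(apply: (pulls_back_regular2 regular2_pivot);
  apply: (pulls_back_regular regular2_pivot)); [
  exists (@pivot C), 0%N
| exists (fun z : GG => 1 : C), 1%N
| exists (fun z : GG => d z.1 * b z.2), 0%N
| exists (fun z : GG => (pivot z * (c z.2 + c z.1 * d z.2)
    - c z.1) * (a z.2)^-1 * (d z.1)^-1), 0%N
| exists (fun z : GG => d z.2 * pivot z * (a z.2)^-1), 0%N
| exists (fun z : GG => (d z.2)^-1 * a z.2), 1%N
| exists (fun z : GG => a z.1 * a z.2), 1%N
| exists (fun z : GG => pivot z * (a z.1)^-1 * (a z.2)^-1), 0%N
| exists (fun z : GG => (b z.2 + b z.1 * a z.2) * pivot z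
    - a z.1 * a z.2 * d z.1 * b z.2), 1%N
| exists (fun z : GG => c z.1), 1%N
| exists (fun z : GG => d z.1 * a z.2), 1%N
| exists (fun z : GG => pivot z * (d z.1)^-1 * (a z.2)^-1), 0%N];
  (split; first by rewrite /pivot; regular2_tac); move=> [x y] [u v];
  rewrite {1}/pivot /= => q0;
  move=> /betaE[/coords_eq[au bu cu du] /coords_eq[av bv cv dv]];
  have [ax dx] := (coord_a_neq0 x, coord_d_neq0 x);
  have [ay dy] := (coord_a_neq0 y, coord_d_neq0 y).
all: rewrite ?(au, bu, cu, du, av, bv, cv, dv) ?expr0 ?expr1 ?divr1 /pivot /=.
all: by field; rewrite ?ax ?dx ?ay ?dy ?q0.
Qed.

Lemma beta_inv_rational : rational_map (fun z w => @beta C w z).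
Proof.
split=> [[u v] [x y] [x' y']|].
  move=> /betaVE[ex ey] /betaVE[ex' ey'].
  by congr (_, _); apply: coords_inj; rewrite ?ex ?ey ?ex' ?ey'.
exists (@copivot C); split; first exact: regular2_copivot.
- have [x ex] := @coords_surj C 1 0 0 1 (oner_neq0 _) (oner_neq0 _).
  exists (x, x); move: ex => [ea eb ec ed].
  by rewrite /copivot /= ed ec mul0r addr0 oner_neq0.
- move=> [u v] q0.
  have [au du] := (coord_a_neq0 u, coord_d_neq0 u).
  have [av dv] := (coord_a_neq0 v, coord_d_neq0 v).
  have [x ex] := @coords_surj C (a v * copivot (u, v) / d v)
    (((b v + b u * a v) * copivot (u, v) - b u) / (a u * d v)) (a u * c v)
    (copivot (u, v)) (mulf_neq0 (mulf_neq0 av q0) (invr_neq0 dv)) q0.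
  have [y ey] := @coords_surj C (a u * d v / copivot (u, v))
    (b u / copivot (u, v)) (c v * (1 - b u * c u) + c u * copivot (u, v) -
       d u * a u * c v * d v / copivot (u, v)) (d u * d v / copivot (u, v))
    (mulf_neq0 (mulf_neq0 au dv) (invr_neq0 q0))
    (mulf_neq0 (mulf_neq0 du dv) (invr_neq0 q0)).
  by exists (x, y); apply/betaVE.
(* Pull-backs of a, a^-1, b, c, d, d^-1, at x and then at y. *)
(apply: (pulls_back_regular2 regular2_copivot);
  apply: (pulls_back_regular regular2_copivot)); [
  exists (fun w => a w.2 * copivot w * (d w.2)^-1), 0%N
| exists (fun w => d w.2 * (a w.2)^-1), 1%N
| exists (fun w => ((b w.2 + b w.1 * a w.2) * copivot w - b w.1)
    * (a w.1)^-1 * (d w.2)^-1), 0%N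
| exists (fun w => a w.1 * c w.2), 0%N
| exists (@copivot C), 0%N
| exists (fun w => 1), 1%N
| exists (fun w => a w.1 * d w.2), 1%N
| exists (fun w => copivot w * (a w.1)^-1 * (d w.2)^-1), 0%N
| exists (fun w => b w.1), 1%N
| exists (fun w => (c w.2 * (1 - b w.1 * c w.1) +
      c w.1 * copivot w) * copivot w -
      d w.1 * a w.1 * c w.2 * d w.2), 1%N
| exists (fun w => d w.1 * d w.2), 1%N
| exists (fun w => copivot w * (d w.1)^-1 * (d w.2)^-1), 0%N];
  (split; first by rewrite /copivot; regular2_tac); move=> [u v] [x y];
  rewrite {1}/copivot /= => q0;
  move=> /betaVE[/coords_eq[ax bx cx dx] /coords_eq[ay by' cy dy]];
  have [au du] := (coord_a_neq0 u, coord_d_neq0 u);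
  have [av dv] := (coord_a_neq0 v, coord_d_neq0 v).
all: rewrite ?(ax, bx, cx, dx, ay, by', cy, dy) ?expr0 ?expr1 ?divr1.
all: rewrite /copivot /=.
all: by field; rewrite ?au ?du ?av ?dv ?q0.
Qed.

End BetaBirational.

(** * Elements that commute up to a scalar *)

Section QCommutation.
Variables (C : fieldType) (q : C).

(** Gaussian binomial coefficients. *)
Fixpoint qbin (n k : nat) : C :=
  match n, k with
  | _, 0 => 1
  | 0, _.+1 => 0
  | n.+1, k.+1 => qbin n k + q ^+ k.+1 * qbin n k.+1
  end.

Lemma qbin0 n : qbin n 0 = 1. Proof. by case: n. Qed.

Lemma qbin_gt n k : (n < k)%N -> qbin n k = 0.
Proof.
elim: n k => [|n IHn] [|k] //= nk.
by rewrite !IHn ?mulr0 ?addr0 // ltnW.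
Qed.

Lemma qbinn n : qbin n n = 1.
Proof. by elim: n => //= n ->; rewrite qbin_gt// mulr0 addr0. Qed.

(** The quotient of consecutive coefficients of a row, in the division-free
    form that survives at a root of unity. *)
Lemma mul_qbin n k : (k <= n)%N ->
  (1 - q ^+ k.+1) * qbin n k.+1 = (1 - q ^+ (n - k)) * qbin n k.
Proof.
elim: n k => [|n IHn] [|k] //= kn.
- by rewrite subnn expr0 subrr mul0r mulr0.
- have := IHn 0%N isT; rewrite subn0 qbin0 mulr1 => e.
  by rewrite mulrDr mulrCA e expr1 subn0 exprS; ring.
move: kn; rewrite ltnS => kn.
have e1 := IHn k kn.
have e2 : (1 - q ^+ k.+2) * qbin n k.+2 = (1 - q ^+ (n - k.+1)) * qbin n k.+1.
  have [kn1|nk] := ltnP k n; first exact: IHn.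
  by rewrite !qbin_gt ?mulr0// ltnS// leqW.
rewrite mulrDr mulrCA e2 subSS mulrDr mulrCA -e1.
have [nk|kn1] := leqP n k; first by rewrite qbin_gt// !mulr0 !addr0.
have -> : (n - k = (n - k.+1).+1)%N by rewrite subnSK.
by rewrite !exprS; ring.
Qed.

(** Absorption gives [(1 - q^k) qbin l k = (1 - q^l) qbin (l - 1) (k - 1) = 0],
    and [1 - q^k] is non-zero as [0 < k < l]. *)
Lemma qbin_root l k : l.-primitive_root q -> (0 < k < l)%N -> qbin l k = 0.
Proof.
move=> ql; case: k => // k /= kl; case: l kl ql => // l kl ql.
have kl' : (k <= l)%N by rewrite -ltnS ltnW.
have : (1 - q ^+ k.+1) * qbin l.+1 k.+1 = (1 - q ^+ l.+1) * qbin l k.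
  rewrite /= mulrDr mulrCA mul_qbin// -[in q ^+ l.+1](subnK kl') -addnS exprD.
  by ring.
rewrite (prim_expr_order ql) subrr mul0r => /eqP.
rewrite mulf_eq0 => /orP[|/eqP//].
rewrite subr_eq0 eq_sym -(prim_order_dvd ql) => /dvdn_leq.
by move=> /(_ isT); rewrite leqNgt kl.
Qed.

Variable A : algType C.
Implicit Types x y : A.

Lemma qcommX x y (p : C) n : x * y = p *: (y * x) ->
  x ^+ n * y = p ^+ n *: (y * x ^+ n).
Proof.
move=> xy; elim: n => [|n IHn]; first by rewrite !expr0 scale1r mul1r mulr1.
rewrite exprS -mulrA IHn -scalerAr [x * (y * _)]mulrA xy -scalerAl scalerA.
by rewrite -exprSr -mulrA.
Qed.

Lemma qcommXr x y (p : C) n : x * y = p *: (y * x) ->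
  x * y ^+ n = p ^+ n *: (y ^+ n * x).
Proof.
move=> xy; elim: n => [|n IHn]; first by rewrite !expr0 scale1r mul1r mulr1.
rewrite exprS mulrA xy -scalerAl -[y * x * _]mulrA IHn -scalerAr scalerA.
by rewrite -(exprS p) !mulrA.
Qed.

Lemma qcomm_exprMn x y (p : C) n : y * x = p *: (x * y) ->
  (x * y) ^+ n = p ^+ 'C(n, 2) *: (x ^+ n * y ^+ n).
Proof.
move=> xy; elim: n => [|n IHn]; first by rewrite bin0n !expr0 scale1r mul1r.
rewrite exprS IHn -scalerAr -mulrA [y * _]mulrA (qcommXr _ xy).
rewrite -scalerAl -scalerAr scalerA -exprD binS bin1; congr (_ *: _).
by rewrite !exprS !mulrA.
Qed.

(** Reordering [(x y)^l] costs [p^(l (l - 1) / 2)], which is a power of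
    [p^l = 1] because [l] is odd. *)
Lemma qcomm_exprMn_odd x y (p : C) l : odd l -> p ^+ l = 1 ->
  y * x = p *: (x * y) -> (x * y) ^+ l = x ^+ l * y ^+ l.
Proof.
move=> lodd pl xy; rewrite (qcomm_exprMn _ xy) (_ : p ^+ _ = 1) ?scale1r//.
rewrite -[in 'C(_, _)](odd_double_half l) lodd add1n bin2odd /= ?odd_double//.
by rewrite doubleK -add1n -[X in (X + _)%N]/(true : nat) -lodd odd_double_half
  exprM pl expr1n.
Qed.

Lemma qbinomial x y n : y * x = q *: (x * y) ->
  (x + y) ^+ n = \sum_(k < n.+1) qbin n k *: (x ^+ k * y ^+ (n - k)).
Proof.
move=> yx; elim: n => [|n IHn].
  by rewrite big_ord_recl big_ord0 /= !expr0 scale1r mulr1 addr0.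
rewrite exprS IHn mulrDl !mulr_sumr.
rewrite [RHS]big_ord_recl /= subn0 expr0 mul1r scale1r.
under [in RHS]eq_bigr => i _ do
  rewrite /bump /= add1n subSS /= scalerDl.
rewrite big_split /= addrCA; congr (_ + _).
  by apply: eq_bigr => i _; rewrite -scalerAr mulrA -exprS.
rewrite big_ord_recl /= qbin0 subn0 expr0 scale1r mul1r -exprS; congr (_ + _).
rewrite [RHS]big_ord_recr /= qbin_gt// mulr0 scale0r addr0.
apply: eq_bigr => i _; rewrite /bump /= add1n.
rewrite -scalerAr mulrA (qcommXr _ yx) -scalerAl scalerA mulrC; congr (_ *: _).
by rewrite -mulrA -exprS subnSK.
Qed.

(** At a primitive [l]-th root of unity the quantum binomial formula loses all
    its middle terms, like the Frobenius map in prime characteristic.  This is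
    why comultiplication and [R] take such simple values on [l]-th powers. *)
Lemma qfrobenius x y l : l.-primitive_root q -> y * x = q *: (x * y) ->
  (x + y) ^+ l = x ^+ l + y ^+ l.
Proof.
move=> ql yx; rewrite (qbinomial _ yx).
case: l ql => [/prim_order_gt0//|l] ql.
rewrite big_ord_recl big_ord_recr /= big1 ?add0r => [|i _].
  have := qbinn l.+1 => /= ->; rewrite /bump /= add1n subnn.
  by rewrite !expr0 !scale1r mulr1 mul1r addrC.
have := @qbin_root _ i.+1 ql; rewrite !ltnS ltn_ord => /(_ isT) ql0.
by rewrite /bump /= add1n; move: ql0 => /= ->; rewrite scale0r.
Qed.

End QCommutation.

(** * Commutativity of the central subalgebra *)

Section Central.
Variables (C : fieldType) (eps : C) (l : nat).
Hypothesis eps_l : eps ^+ l = 1.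
Hypothesis eps0 : eps != 0.

Local Notation K := (uK : U eps).
Local Notation KV := (uKV : U eps).
Local Notation L := (uL : U eps).
Local Notation LV := (uLV : U eps).
Local Notation E := (uE : U eps).
Local Notation F := (uF : U eps).

Let eps2l : (eps ^+ 2) ^+ l = 1.
Proof. by rewrite -exprM mulnC exprM eps_l expr1n. Qed.

Let epsV2l : (eps ^- 2) ^+ l = 1.
Proof. by rewrite exprVn eps2l invr1. Qed.

Lemma qcommV (A : algType C) (x xV y : A) (p : C) : p != 0 ->
  x * xV = 1 -> xV * x = 1 ->
  x * y = p *: (y * x) -> xV * y = p^-1 *: (y * xV).
Proof.
move=> p0 xxV xVx xy.
have -> : y * xV = xV * (x * y) * xV by rewrite mulrA xVx mul1r.
rewrite xy -scalerAr -scalerAl scalerA mulVf// scale1r.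
by rewrite -!mulrA xxV mulr1.
Qed.

Lemma uKVE : KV * E = eps ^- 2 *: (E * KV).
Proof. by apply: qcommV (uKKV _) (uKVK _) (uKE _); rewrite expf_neq0. Qed.

Lemma uKVF : KV * F = eps ^+ 2 *: (F * KV).
Proof.
rewrite -[eps ^+ 2]invrK.
by apply: qcommV (uKKV _) (uKVK _) (uKF _); rewrite invr_neq0// expf_neq0.
Qed.

Lemma uLVE : LV * E = eps ^- 2 *: (E * LV).
Proof. by apply: qcommV (uLLV _) (uLVL _) (uLE _); rewrite expf_neq0. Qed.

Lemma uLVF : LV * F = eps ^+ 2 *: (F * LV).
Proof.
rewrite -[eps ^+ 2]invrK.
by apply: qcommV (uLLV _) (uLVL _) (uLF _); rewrite invr_neq0// expf_neq0.
Qed.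

(** The commutator formula familiar from quantum [sl_2]: both coefficients
    vanish when the exponent is [l], which makes [E^l] commute with [F]. *)
Lemma uEXF n : E ^+ n.+1 * F - F * E ^+ n.+1 =
  E ^+ n * ((eps ^- 1 * (eps ^+ (2 * n.+1) - 1)) *: K -
            (eps * (1 - eps ^- (2 * n.+1))) *: LV).
Proof.
elim: n => [|n IHn].
  rewrite !expr1 expr0 mul1r uEF scalerBr; congr (_ *: _ - _ *: _);
    by rewrite muln1; field.
have -> : E ^+ n.+2 * F - F * E ^+ n.+2 =
  E * (E ^+ n.+1 * F - F * E ^+ n.+1) + (E * F - F * E) * E ^+ n.+1.
  by rewrite [E ^+ n.+2]exprS mulrBr mulrBl !mulrA addrA subrK.
rewrite IHn uEF mulrA -exprS.
rewrite -scalerAl mulrBl (qcommXr _ (uKE _)) (qcommXr _ uLVE).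
rewrite !scalerBr !scalerA !mulrBr -!scalerAr addrACA -opprD -!scalerDl.
rewrite [(2 * n.+2)%N]mulnS [(2 + _)%N]addnC exprVn -!exprM !exprD.
congr (_ *: _ - _ *: _); field; rewrite ?expf_neq0 ?eps0 //.
Qed.

Lemma uElF : (0 < l)%N -> E ^+ l * F = F * E ^+ l.
Proof.
move=> l0; apply/eqP; rewrite -subr_eq0 -(prednK l0) uEXF (prednK l0).
by rewrite exprM eps2l subrr mulr0 invr1 subrr mulr0 !scale0r subrr mulr0.
Qed.

Lemma comm_pow (A : algType C) (x y : A) (p : C) : p ^+ l = 1 ->
  x * y = p *: (y * x) -> GRing.comm (x ^+ l) (y ^+ l).
Proof.
move=> pl xy; apply: commrX; rewrite /GRing.comm (qcommX _ xy) pl.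
by rewrite scale1r.
Qed.

Hypothesis l0 : (0 < l)%N.

Lemma inZ0_comm_gen (u : U eps) :
  (forall g : Ugen, GRing.comm u (pgen (Urel eps) g ^+ l)) ->
  forall v, inZ0 l v -> GRing.comm u v.
Proof.
move=> ug v; elim.
- exact: ug gE.
- exact: ug gF.
- exact: ug gK.
- exact: ug gKV.
- exact: ug gL.
- exact: ug gLV.
- exact: commr1.
- by move=> k w _ uw; rewrite /GRing.comm -scalerAr uw -scalerAl.
- by move=> w w' _ uw _ uw'; exact: commrD.
- by move=> w w' _ uw _ uw'; exact: commrM.
Qed.

Lemma gen_pow_comm (g h : Ugen) :
  GRing.comm (pgen (Urel eps) g ^+ l) (pgen (Urel eps) h ^+ l).
Proof.
have c1 (x y : U eps) : GRing.comm x y -> GRing.comm (x ^+ l) (y ^+ l).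
  by move=> xy; apply: commrX; apply/commr_sym/commrX/commr_sym.
have EF : GRing.comm (E ^+ l) (F ^+ l) by apply: commrX; exact: uElF.
have KE := comm_pow eps2l (uKE eps). have KF := comm_pow epsV2l (uKF eps).
have LE := comm_pow eps2l (uLE eps). have LF := comm_pow epsV2l (uLF eps).
have KVE := comm_pow epsV2l uKVE. have KVF := comm_pow eps2l uKVF.
have LVE := comm_pow epsV2l uLVE. have LVF := comm_pow eps2l uLVF.
have KKV : GRing.comm K KV by rewrite /GRing.comm uKKV uKVK.
have LLV : GRing.comm L LV by rewrite /GRing.comm uLLV uLVL.
have KL : GRing.comm K L := uKL eps.
have KLV : GRing.comm K LV := uKLV eps.
have mV (x xV y : U eps) : x * xV = 1 -> xV * x = 1 ->
  GRing.comm x y -> GRing.comm xV y.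
  move=> xxV xVx xy; rewrite /GRing.comm.
  by rewrite -[RHS]mul1r -xVx -mulrA [x * _]mulrA xy -!mulrA xxV mulr1.
have KVL := mV _ _ _ (uKKV _) (uKVK _) KL.
have KVLV := mV _ _ _ (uKKV _) (uKVK _) KLV.
case: g; case: h; first [exact: commr_refl
  | assumption | apply: commr_sym; assumption
  | apply: c1; assumption | apply: commr_sym; apply: c1; assumption].
Qed.

Lemma inZ0_comm (u v : U eps) : inZ0 l u -> inZ0 l v -> GRing.comm u v.
Proof.
move=> Zu Zv; apply: inZ0_comm_gen Zv => g; apply: commr_sym.
by apply: inZ0_comm_gen Zu => h; exact: gen_pow_comm.
Qed.

End Central.

(** * The automorphism on powers of the generators *)

Section RAutomorphism.
Variables (C : fieldType) (eps : C) (l : nat).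
Hypothesis lodd : odd l.
Hypothesis eps_prim : l.-primitive_root eps.

Local Notation K := (uK : U eps).
Local Notation KV := (uKV : U eps).
Local Notation L := (uL : U eps).
Local Notation LV := (uLV : U eps).
Local Notation E := (uE : U eps).
Local Notation F := (uF : U eps).

Let eps_l : eps ^+ l = 1. Proof. exact: prim_expr_order. Qed.
Let l0 : (0 < l)%N. Proof. exact: prim_order_gt0 eps_prim. Qed.
Let eps0 : eps != 0.
Proof. by rewrite (prim_root_eq0 eps_prim) -lt0n. Qed.

Let eps2l : (eps ^+ 2) ^+ l = 1.
Proof. by rewrite -exprM mulnC exprM eps_l expr1n. Qed.

Lemma eps2_prim : l.-primitive_root (eps ^+ 2).
Proof. by rewrite prim_root_exp_coprime// coprime2n. Qed.

Lemma tensX (u v : U eps) n : (u \ox v) ^+ n = u ^+ n \ox v ^+ n.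
Proof. by elim: n => [|n IHn]; rewrite ?expr0 ?tens1 // !exprS IHn tensM. Qed.

(** [R] is given through [1 - eps Rarg]; its behaviour on the centre goes
    through [Rden], which is [1 - Rarg^l]. *)
Definition Rarg : UU eps := (KV * E) \ox (F * L).
Definition Rden : UU eps := 1 - (KV ^+ l * E ^+ l) \ox (F ^+ l * L ^+ l).

(** The counit of the tensor square kills [E] in the first factor, hence sends
    the element to [1]. *)
Lemma one_minus_tens_neq0 (k : C) (u v : U eps) n : (0 < n)%N ->
  1 - k *: ((u * E ^+ n) \ox v) != 0.
Proof.
move=> n0; apply/eqP => e.
have [p1 _] := plift_monoid (@counit2_rel C eps).
have pl := plift_linear (@counit2_rel C eps).
have [_ cM] := plift_monoid (@counit_rel C eps).
have : plift (@counit2_gen C eps) ((u * E ^+ n) \ox v) = 0.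
  rewrite /tens (plift_gen (@counit2_rel C eps)) /counit2_gen /=.
  rewrite -(prednK n0) exprSr mulrA /counit cM.
  by rewrite [plift _ uE](plift_gen (@counit_rel C eps)) mulr0 mul0r.
move=> r0.
have := pl (- k) ((u * E ^+ n) \ox v) 1.
rewrite scaleNr [- _ + 1]addrC e r0 scaler0 add0r p1.
have := pl (-1) 0 0; rewrite scaler0 add0r scaleN1r addNr => ->.
by move/eqP; rewrite eq_sym oner_eq0.
Qed.

Lemma Rden_neq0 : Rden != 0.
Proof.
have := one_minus_tens_neq0 1 (KV ^+ l) (F ^+ l * L ^+ l) l0.
by rewrite scale1r.
Qed.

Lemma Delta_E_pow : Delta (E ^+ l) = E ^+ l \ox K ^+ l + 1 \ox E ^+ l.
Proof.
rewrite rmorphXn /= (plift_gen (@Delta_rel C eps) gE : Delta E = _) /=.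
rewrite addrC (qfrobenius eps2_prim).
  by rewrite !tensX expr1n addrC.
by rewrite -!tensM !mulr1 !mul1r uKE tensZr.
Qed.

Lemma Delta_F_pow : Delta (F ^+ l) = F ^+ l \ox 1 + LV ^+ l \ox F ^+ l.
Proof.
rewrite rmorphXn /= (plift_gen (@Delta_rel C eps) gF : Delta F = _) /=.
rewrite (qfrobenius eps2_prim).
  by rewrite !tensX expr1n.
by rewrite -!tensM !mulr1 !mul1r uLVF// tensZl.
Qed.

Variables (D : unitAlgType C) (iota : {lrmorphism UU eps -> D}).
Variable Rm : {lrmorphism D -> D}.
Hypothesis fracD : is_division_ring_of_fractions iota.
Hypothesis RmP : is_R_automorphism iota Rm.

Lemma iota_unit t : t != 0 -> iota t \is a GRing.unit.
Proof.
move=> t0; apply: (divring_unit fracD).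
by rewrite -(rmorph0 iota) (inj_eq (divring_inj fracD)).
Qed.

Let psi (t : UU eps) : D := Rm (iota t).
Let psiM s t : psi (s * t) = psi s * psi t.
Proof. by rewrite /psi !rmorphM. Qed.
Let psiX s n : psi (s ^+ n) = psi s ^+ n.
Proof. by rewrite /psi !rmorphXn. Qed.
Let psiD s t : psi (s + t) = psi s + psi t.
Proof. by rewrite /psi !rmorphD. Qed.
Let psi1 : psi 1 = 1.
Proof. by rewrite /psi !rmorph1. Qed.

Local Notation tau := (iota Rden).
Lemma Rden_unit : tau \is a GRing.unit.
Proof. exact: iota_unit Rden_neq0. Qed.

(** The inverse [MV] of a generator is easier to handle than [M]: its image
    under [R] is a polynomial. *)
Lemma R_1_inv (M MV : U eps) : M * MV = 1 -> MV * M = 1 ->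
  psi (1 \ox M) = iota (1 \ox M) * (1 - eps *: iota Rarg)^-1 ->
  psi (1 \ox MV) = iota ((1 - eps *: Rarg) * (1 \ox MV)).
Proof.
move=> MMV MVM eM.
have w0 : iota (1 - eps *: Rarg) \is a GRing.unit.
  apply: iota_unit.
  by have := one_minus_tens_neq0 eps KV (F * L) (ltn0Sn 0); rewrite expr1.
have ew : 1 - eps *: iota Rarg = iota (1 - eps *: Rarg).
  by rewrite rmorphB rmorph1; congr (_ - _); rewrite [RHS]linearZ_LR.
have : psi (1 \ox MV) * psi (1 \ox M) = 1.
  by rewrite -psiM -tensM mul1r MVM tens1 psi1.
rewrite eM ew => e.
rewrite rmorphM -[RHS]mul1r -e -!mulrA -[LHS]mulr1; congr (_ * _).
by rewrite mulKr// -rmorphM -tensM mul1r MMV tens1 rmorph1.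
Qed.

(** The two terms of [(1 - eps Rarg) (1 (x) M)] commute up to [eps^2], so its
    [l]-th power is the sum of their [l]-th powers; oddness of [l] makes the
    second one [- Rarg^l (1 (x) M^l)]. *)
Lemma R_1_inv_pow (M : U eps) : M * F = eps ^+ 2 *: (F * M) -> GRing.comm L M ->
  psi (1 \ox M) = iota ((1 - eps *: Rarg) * (1 \ox M)) ->
  psi (1 \ox M ^+ l) = tau * iota (1 \ox M ^+ l).
Proof.
move=> MF LM eM.
rewrite -[1 in LHS](expr1n _ l) -tensX psiX eM -rmorphXn -rmorphM.
congr (iota _).
rewrite /Rarg mulrBl mul1r -scalerAl -tensM mulr1.
set X := (KV * E) \ox _.
have MX : (1 \ox M) * - (eps *: X) = eps ^+ 2 *: (- (eps *: X) * (1 \ox M)).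
  rewrite mulNr mulrN scalerN; congr (- _).
  rewrite -scalerAl -scalerAr scalerA mulrC -scalerA; congr (_ *: _).
  rewrite /X -!tensM mulr1 mul1r -tensZr; congr (_ \ox _).
  by rewrite !mulrA MF -!scalerAl -[F * M * L]mulrA -LM !mulrA.
rewrite [_ - _]addrC (qfrobenius eps2_prim MX) addrC tensX expr1n mulrBl.
rewrite mul1r; congr (_ + _).
rewrite exprNn -signr_odd lodd expr1 mulN1r exprZn eps_l scale1r tensX.
rewrite -tensM mulr1; congr (- (_ \ox _)).
  rewrite (@qcomm_exprMn_odd _ _ _ _ (eps ^+ 2) _ lodd)//.
  by rewrite uKVE// scalerA mulfV ?scale1r// expf_neq0.
have FLM : GRing.comm F (L * M).
  rewrite /GRing.comm -mulrA MF -scalerAr [L * (F * M)]mulrA uLF -scalerAl.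
  by rewrite scalerA mulfV ?expf_neq0// scale1r mulrA.
by rewrite -!mulrA exprMn_comm// exprMn_comm.
Qed.

(** * Functions represented in the localized central subalgebra *)

Variable phi : U eps -> GL2star C -> C.
Hypothesis phiP : is_Z0_identification l phi.

Local Notation a := (@coord_a C).
Local Notation b := (@coord_b C).
Local Notation c := (@coord_c C).
Local Notation d := (@coord_d C).
Local Notation GG := (GL2star C * GL2star C)%type.
Implicit Types (z w : GG) (x y : GL2star C).

Local Notation Z0 := (@inZ0 C eps l).
Local Notation ZZ := (Z0Z0_function l phi).

Lemma Z0Z0_ext s f g : (forall z, f z = g z) -> ZZ s f -> ZZ s g.
Proof. by move=> fg [r [Zr -> er]]; exists r; split=> // x y; rewrite -fg. Qed.

Lemma Z0Z0_tens u v : Z0 u -> Z0 v ->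
  ZZ (u \ox v) (fun z => phi u z.1 * phi v z.2).
Proof.
move=> Zu Zv; exists [:: (u, v)]; split=> [p| |x y]; rewrite ?big_seq1//.
by rewrite inE => /eqP->.
Qed.

Lemma Z0Z0_D s t f g : ZZ s f -> ZZ t g -> ZZ (s + t) (fun z => f z + g z).
Proof.
move=> [p [Zp -> ep]] [r [Zr -> er]]; exists (p ++ r).
split=> [i| |x y]; rewrite ?big_cat ?ep ?er//.
by rewrite mem_cat => /orP[/Zp|/Zr].
Qed.

Lemma Z0Z0_M s t f g : ZZ s f -> ZZ t g -> ZZ (s * t) (fun z => f z * g z).
Proof.
move=> [p [Zp -> ep]] [r [Zr -> er]].
exists [seq (i.1 * j.1, i.2 * j.2) | i <- p, j <- r]; split.
- move=> _ /allpairsP[[i j] /= [/Zp[Zi1 Zi2] /Zr[Zj1 Zj2] ->]].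
  by split; apply: inZ0_M.
- rewrite big_allpairs_dep big_distrlr /=.
  by apply: eq_bigr => i _; apply: eq_bigr => j _; rewrite tensM.
move=> x y; rewrite ep er big_allpairs_dep big_distrlr /=.
apply: eq_big_seq => i /Zp[Zi1 Zi2]; apply: eq_big_seq => j /Zr[Zj1 Zj2] /=.
by rewrite !(phi_M phiP)// mulrACA.
Qed.

Lemma Z0Z0_cst k : ZZ k%:A (fun=> k).
Proof.
rewrite -tens1 -tensZl.
apply: Z0Z0_ext (Z0Z0_tens (inZ0_Z _ (inZ0_1 _ _)) (inZ0_1 _ _)) => z.
by rewrite (phi_Z phiP) ?(phi_1 phiP) ?mulr1//; exact: inZ0_1.
Qed.

Lemma Z0Z0_1 : ZZ 1 (fun=> 1).
Proof. by have := Z0Z0_cst 1; rewrite scale1r. Qed.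

Lemma Z0Z0_N s f : ZZ s f -> ZZ (- s) (fun z => - f z).
Proof.
move=> Zs; rewrite -scaleN1r -[s]mul1r scalerAl.
by apply: Z0Z0_ext (Z0Z0_M (Z0Z0_cst (-1)) Zs) => z; rewrite mulN1r.
Qed.

Lemma Z0Z0_X s f n : ZZ s f -> ZZ (s ^+ n) (fun z => f z ^+ n).
Proof.
move=> Zs; elim: n => [|n IHn].
  by rewrite expr0; apply: Z0Z0_ext Z0Z0_1 => z; rewrite expr0.
by rewrite exprS; apply: Z0Z0_ext (Z0Z0_M Zs IHn) => z; rewrite exprS.
Qed.

Lemma Z0Z0_comm s t f g : ZZ s f -> ZZ t g -> GRing.comm s t.
Proof.
move=> [p [Zp -> _]] [r [Zr -> _]].
rewrite /GRing.comm !big_distrlr exchange_big /=.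
apply: eq_big_seq => j /Zr[Zj1 Zj2]; apply: eq_big_seq => i /Zp[Zi1 Zi2].
have comm := inZ0_comm eps_l eps0 l0.
by rewrite -!tensM (comm _ _ Zi1 Zj1) (comm _ _ Zi2 Zj2).
Qed.

Lemma phi_inv u v : Z0 u -> Z0 v -> u * v = 1 ->
  forall x, phi v x = (phi u x)^-1.
Proof.
move=> Zu Zv uv x; have e : phi u x * phi v x = 1.
  have := phi_M phiP Zu Zv; rewrite uv (phi_1 phiP).
  by move=> /(congr1 (fun f => f x)).
have u0 : phi u x != 0.
  by apply: contra_eq_neq e => ->; rewrite mul0r eq_sym oner_neq0.
by apply: (mulfI u0); rewrite e mulfV.
Qed.

Lemma phi_KV x : phi (KV ^+ l) x = d x.
Proof.
rewrite (@phi_inv (K ^+ l)) ?(phi_K phiP) ?invrK//; try constructor.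
by rewrite -exprMn_comm ?uKKV ?expr1n// /GRing.comm uKKV uKVK.
Qed.

Lemma phi_LV x : phi (LV ^+ l) x = a x.
Proof.
rewrite (@phi_inv (L ^+ l)) ?(phi_L phiP) ?invrK//; try constructor.
by rewrite -exprMn_comm ?uLLV ?expr1n// /GRing.comm uLLV uLVL.
Qed.

Definition Rden_fun (z : GG) : C := pivot z / a z.2.

Lemma Z0Z0_Rden : ZZ Rden Rden_fun.
Proof.
have Zu : Z0 (KV ^+ l * E ^+ l) by apply: inZ0_M; constructor.
have Zv : Z0 (F ^+ l * L ^+ l) by apply: inZ0_M; constructor.
apply: Z0Z0_ext (Z0Z0_D Z0Z0_1 (Z0Z0_N (Z0Z0_tens Zu Zv))) => z.
rewrite !(phi_M phiP); try constructor.
rewrite phi_KV (phi_E phiP) (phi_F phiP) (phi_L phiP) /Rden_fun /pivot.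
by have [a0 d0] := (coord_a_neq0 z.2, coord_d_neq0 z.1); field; rewrite a0 d0.
Qed.

Lemma beta_pivot_neq0 z w : beta z w -> pivot z != 0.
Proof.
case: z w => [x y] [u v] /betaE[/coords_eq[<- _ _ _] _].
exact: coord_a_neq0.
Qed.

Lemma Rden_fun_neq0 z w : beta z w -> Rden_fun z != 0.
Proof.
by move=> /beta_pivot_neq0 z0; rewrite mulf_neq0// invr_neq0// coord_a_neq0.
Qed.

(** [r] lies in the localization of the central subalgebra at [Rden], and on
    the graph of [beta] its function agrees with [H z w], where [z] is [(x, y)]
    and [w] is [(x_L, x_R)].  Allowing only powers of [Rden] as denominators
    makes such elements stable under sums and products, and [Rden_fun] never
    vanishes on the graph. *)
Definition denotes (r : D) (H : GG -> GG -> C) : Prop := exists s f k,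
  [/\ ZZ s f, r = iota s / tau ^+ k &
      forall z w, beta z w -> H z w = f z / Rden_fun z ^+ k].

Lemma denotes_ext r H H' : (forall z w, beta z w -> H z w = H' z w) ->
  denotes r H -> denotes r H'.
Proof.
move=> HH' [s [f [k [Zs er eH]]]]; exists s, f, k; split=> // z w zw.
by rewrite -HH'// eH.
Qed.

Lemma denotes_iota s f : ZZ s f -> denotes (iota s) (fun z _ => f z).
Proof.
by move=> Zs; exists s, f, 0%N; split=> // *; rewrite expr0 divr1.
Qed.

Lemma denotes_RdenV : denotes tau^-1 (fun z _ => (Rden_fun z)^-1).
Proof.
exists 1, (fun=> 1), 1%N; split=> [||z w _]; first exact: Z0Z0_1.
  by rewrite rmorph1 mul1r expr1.
by rewrite expr1 mul1r.
Qed.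

Lemma denotes_D r1 r2 H1 H2 : denotes r1 H1 -> denotes r2 H2 ->
  denotes (r1 + r2) (fun z w => H1 z w + H2 z w).
Proof.
move=> [s1 [f1 [k1 [Z1 -> e1]]]] [s2 [f2 [k2 [Z2 -> e2]]]].
exists (s1 * Rden ^+ k2 + s2 * Rden ^+ k1),
  (fun z => f1 z * Rden_fun z ^+ k2 + f2 z * Rden_fun z ^+ k1), (k1 + k2)%N.
split.
- by apply: Z0Z0_D; apply: Z0Z0_M => //; apply: Z0Z0_X; exact: Z0Z0_Rden.
- rewrite [iota (s1 * _ + _)]rmorphD !rmorphM !rmorphXn mulrDl; congr (_ + _).
    by rewrite exprD invrM ?unitrX ?Rden_unit// mulrA mulrK ?unitrX ?Rden_unit.
  rewrite addnC exprD invrM ?unitrX ?Rden_unit// mulrA.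
  by rewrite mulrK ?unitrX ?Rden_unit.
move=> z w zw; have t0 := Rden_fun_neq0 zw.
by rewrite (e1 z w)// (e2 z w)// exprD; field; rewrite !expf_neq0.
Qed.

Lemma denotes_M r1 r2 H1 H2 : denotes r1 H1 -> denotes r2 H2 ->
  denotes (r1 * r2) (fun z w => H1 z w * H2 z w).
Proof.
move=> [s1 [f1 [k1 [Z1 -> e1]]]] [s2 [f2 [k2 [Z2 -> e2]]]].
exists (s1 * s2), (fun z => f1 z * f2 z), (k1 + k2)%N; split.
- exact: Z0Z0_M.
- have cm : GRing.comm (iota s2) (tau ^- k1).
    apply: commrV; apply: commrX; rewrite /GRing.comm -!rmorphM.
    by rewrite (Z0Z0_comm Z2 Z0Z0_Rden).
  rewrite addnC exprD invrM ?unitrX ?Rden_unit// rmorphM -!mulrA; congr (_ * _).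
  by rewrite mulrA -cm mulrA.
move=> z w zw; have t0 := Rden_fun_neq0 zw.
by rewrite (e1 z w)// (e2 z w)// exprD; field; rewrite !expf_neq0.
Qed.

Lemma denotes_Z r H k : denotes r H -> denotes (k *: r) (fun z w => k * H z w).
Proof.
move=> dr; rewrite -[r]mul1r scalerAl.
have -> : k *: 1 = iota (k *: 1) by rewrite [RHS]linearZ_LR rmorph1.
exact: denotes_M (denotes_iota (Z0Z0_cst k)) dr.
Qed.

Lemma denotes_B r1 r2 H1 H2 : denotes r1 H1 -> denotes r2 H2 ->
  denotes (r1 - r2) (fun z w => H1 z w - H2 z w).
Proof.
move=> d1 d2; rewrite -scaleN1r.
apply: denotes_ext (denotes_D d1 (denotes_Z (-1) d2)) => z w _.
by rewrite mulN1r.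
Qed.

Let psi_pair (M MV N NV : UU eps) : M * MV = 1 -> NV * N = 1 ->
  psi M = iota N -> psi MV = iota NV.
Proof.
move=> MMV NVN eM.
by rewrite -[RHS]mulr1 -psi1 -MMV psiM eM mulrA -rmorphM NVN rmorph1 mul1r.
Qed.

Lemma KVK_pow : KV ^+ l * K ^+ l = 1.
Proof. by rewrite -exprMn_comm ?uKVK ?expr1n// /GRing.comm uKKV uKVK. Qed.
Lemma KKV_pow : K ^+ l * KV ^+ l = 1.
Proof. by rewrite -exprMn_comm ?uKKV ?expr1n// /GRing.comm uKKV uKVK. Qed.
Lemma LVL_pow : LV ^+ l * L ^+ l = 1.
Proof. by rewrite -exprMn_comm ?uLVL ?expr1n// /GRing.comm uLLV uLVL. Qed.
Lemma LLV_pow : L ^+ l * LV ^+ l = 1.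
Proof. by rewrite -exprMn_comm ?uLLV ?expr1n// /GRing.comm uLLV uLVL. Qed.

Lemma R_1KV : psi (1 \ox KV ^+ l) = tau * iota (1 \ox KV ^+ l).
Proof.
apply: (R_1_inv_pow (uKVF eps0)).
  rewrite /GRing.comm -[LHS]mul1r -(uKVK eps) -mulrA [K * _]mulrA uKL.
  by rewrite -!mulrA uKKV mulr1.
exact: (R_1_inv (uKKV _) (uKVK _) (Rm_1K RmP)).
Qed.

Lemma R_1LV : psi (1 \ox LV ^+ l) = tau * iota (1 \ox LV ^+ l).
Proof.
apply: (R_1_inv_pow (uLVF eps0)).
  by rewrite /GRing.comm uLLV uLVL.
exact: (R_1_inv (uLLV _) (uLVL _) (Rm_1L RmP)).
Qed.

Lemma R_1_pow (M MV : U eps) : M * MV = 1 -> MV * M = 1 ->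
  psi (1 \ox MV) = tau * iota (1 \ox MV) ->
  psi (1 \ox M) = iota (1 \ox M) * tau^-1.
Proof.
move=> MMV MVM eMV.
have e : psi (1 \ox M) * (tau * iota (1 \ox MV)) = 1.
  by rewrite -eMV -psiM -tensM mul1r MMV tens1 psi1.
rewrite -[RHS]mul1r -e -!mulrA [iota (1 \ox MV) * _]mulrA -rmorphM -tensM.
by rewrite mul1r MVM tens1 rmorph1 mul1r mulrV ?Rden_unit// mulr1.
Qed.

Lemma R_KK : psi (K ^+ l \ox K ^+ l) = iota (K ^+ l \ox K ^+ l).
Proof.
have := Rm_Delta RmP (_ : K \in _); rewrite !inE eqxx => /(_ isT).
rewrite (plift_gen (@Delta_rel C eps) gK : Delta K = _) /= sigma_tens => e.
by rewrite -tensX psiX [psi _]e -rmorphXn.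
Qed.

Lemma R_LL : psi (L ^+ l \ox L ^+ l) = iota (L ^+ l \ox L ^+ l).
Proof.
have := Rm_Delta RmP (_ : L \in _); rewrite !inE eqxx orbT => /(_ isT).
rewrite (plift_gen (@Delta_rel C eps) gL : Delta L = _) /= sigma_tens => e.
by rewrite -tensX psiX [psi _]e -rmorphXn.
Qed.

Lemma R_KVKV : psi (KV ^+ l \ox KV ^+ l) = iota (KV ^+ l \ox KV ^+ l).
Proof.
by apply: psi_pair R_KK; rewrite -tensM ?KKV_pow ?KVK_pow tens1.
Qed.

Lemma R_LVLV : psi (LV ^+ l \ox LV ^+ l) = iota (LV ^+ l \ox LV ^+ l).
Proof.
by apply: psi_pair R_LL; rewrite -tensM ?LLV_pow ?LVL_pow tens1.
Qed.

Lemma R_E1 : psi (E ^+ l \ox 1) = iota (E ^+ l \ox L ^+ l).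
Proof.
by rewrite -[1](expr1n _ l) -!tensX psiX [psi _](Rm_E1 RmP) rmorphXn.
Qed.

Lemma R_1F : psi (1 \ox F ^+ l) = iota (KV ^+ l \ox F ^+ l).
Proof.
by rewrite -[1](expr1n _ l) -!tensX psiX [psi _](Rm_1F RmP) rmorphXn.
Qed.

(** As [Delta], [sigma] and [R] are multiplicative, the condition
    [R (Delta E) = sigma (Delta E)] passes to [E^l], whose comultiplication is
    again two-termed. *)
Lemma R_DeltaE : psi (E ^+ l \ox K ^+ l) + psi (1 \ox E ^+ l) =
  iota (K ^+ l \ox E ^+ l + E ^+ l \ox 1).
Proof.
rewrite -psiD -Delta_E_pow rmorphXn psiX.
rewrite [psi _](Rm_Delta RmP) ?inE ?eqxx ?orbT//.
rewrite -rmorphXn -rmorphXn -rmorphXn /= Delta_E_pow.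
by rewrite rmorphD /= !sigma_tens.
Qed.

Lemma R_DeltaF : psi (F ^+ l \ox 1) + psi (LV ^+ l \ox F ^+ l) =
  iota (1 \ox F ^+ l + F ^+ l \ox LV ^+ l).
Proof.
rewrite -psiD -Delta_F_pow rmorphXn psiX.
rewrite [psi _](Rm_Delta RmP) ?inE ?eqxx ?orbT//.
rewrite -rmorphXn -rmorphXn -rmorphXn /= Delta_F_pow.
by rewrite rmorphD /= !sigma_tens.
Qed.

(** Evaluation is crossed: the first tensor factor is taken at [x_R = w.2], the
    second one at [x_L = w.1]. *)
Definition pulled_back (u : U eps) : Prop :=
  denotes (psi (u \ox 1)) (fun _ w => phi u w.2) /\
  denotes (psi (1 \ox u)) (fun _ w => phi u w.1).

Lemma psi_tens u v : psi (u \ox v) = psi (u \ox 1) * psi (1 \ox v).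
Proof. by rewrite -psiM -tensM mulr1 mul1r. Qed.

Let dT u v (Zu : Z0 u) (Zv : Z0 v) := denotes_iota (Z0Z0_tens Zu Zv).
Let phi1 x : phi 1 x = 1. Proof. by rewrite (phi_1 phiP). Qed.
Let phiK x : phi (K ^+ l) x = (d x)^-1. Proof. by rewrite (phi_K phiP). Qed.
Let phiL x : phi (L ^+ l) x = (a x)^-1. Proof. by rewrite (phi_L phiP). Qed.
Let phiF x : phi (F ^+ l) x = b x. Proof. by rewrite (phi_F phiP). Qed.
Let phiE x : phi (E ^+ l) x = - c x / d x. Proof. by rewrite (phi_E phiP). Qed.
Let phi_gens := (phi1, phiK, phiL, phiF, phiE, phi_KV, phi_LV).

(** On the graph of [beta], identities between functions become identities
    between rational functions of the coordinates of [x] and [y]; the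
    hypotheses are stated as rewriting rules. *)
Lemma beta_elim (H H' : GG -> GG -> C) :
  (forall x y u v, let q := a y + c x * b y in
    (a x != 0) * (d x != 0) * (a y != 0) * (d y != 0) * (q != 0) ->
    (a u = q) * (b u = d x * b y) *
    (c u = (q * (c y + c x * d y) - c x) / (a y * d x)) *
    (d u = d y * q / a y) * (a v = a x * a y / q) *
    (b v = b y + b x * a y - a x * a y * d x * b y / q) *
    (c v = c x / q) * (d v = d x * a y / q) ->
    H (x, y) (u, v) = H' (x, y) (u, v)) ->
  forall z w, beta z w -> H z w = H' z w.
Proof.
move=> e [x y] [u v] zw; have q0 : a y + c x * b y != 0 := beta_pivot_neq0 zw.
apply: e; first by rewrite !coord_a_neq0 !coord_d_neq0.
by move: zw => /betaE[/coords_eq[-> -> -> ->] /coords_eq[-> -> -> ->]].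
Qed.

Ltac by_coords := let x := fresh in let y := fresh in let u := fresh in
  let v := fresh in let q := fresh in let ne := fresh in let eq := fresh in
  apply: beta_elim => x y u v q ne eq;
  rewrite /= ?phi_gens /Rden_fun /pivot /= ?eq -/q; field; rewrite ?ne.

(** Values of [R] on [u (x) 1] come from those on group-like elements. *)
Lemma psi_tens_cancel (M MV : U eps) u : M * MV = 1 ->
  psi (u \ox 1) = psi (u \ox M) * psi (1 \ox MV).
Proof. by move=> MMV; rewrite -psiM -tensM MMV mulr1. Qed.

Lemma pulled_back_KV : pulled_back (KV ^+ l).
Proof.
split.
  rewrite (psi_tens_cancel _ KVK_pow) R_KVKV (R_1_pow KKV_pow KVK_pow R_1KV).
  apply: denotes_ext (denotes_M (dT (inZ0_KV _ _) (inZ0_KV _ _))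
    (denotes_M (dT (inZ0_1 _ _) (inZ0_K _ _)) denotes_RdenV)).
  by by_coords.
rewrite R_1KV.
apply: denotes_ext (denotes_M (denotes_iota Z0Z0_Rden)
  (dT (inZ0_1 _ _) (inZ0_KV _ _))).
by by_coords.
Qed.

Lemma pulled_back_LV : pulled_back (LV ^+ l).
Proof.
split.
  rewrite (psi_tens_cancel _ LVL_pow) R_LVLV (R_1_pow LLV_pow LVL_pow R_1LV).
  apply: denotes_ext (denotes_M (dT (inZ0_LV _ _) (inZ0_LV _ _))
    (denotes_M (dT (inZ0_1 _ _) (inZ0_L _ _)) denotes_RdenV)).
  by by_coords.
rewrite R_1LV.
apply: denotes_ext (denotes_M (denotes_iota Z0Z0_Rden)
  (dT (inZ0_1 _ _) (inZ0_LV _ _))).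
by by_coords.
Qed.

Lemma pulled_back_K : pulled_back (K ^+ l).
Proof.
split.
  rewrite (psi_tens_cancel _ KKV_pow) R_KK R_1KV.
  apply: denotes_ext (denotes_M (dT (inZ0_K _ _) (inZ0_K _ _))
    (denotes_M (denotes_iota Z0Z0_Rden) (dT (inZ0_1 _ _) (inZ0_KV _ _)))).
  by by_coords.
rewrite (R_1_pow KKV_pow KVK_pow R_1KV).
apply: denotes_ext (denotes_M (dT (inZ0_1 _ _) (inZ0_K _ _)) denotes_RdenV).
by by_coords.
Qed.

Lemma pulled_back_L : pulled_back (L ^+ l).
Proof.
split.
  rewrite (psi_tens_cancel _ LLV_pow) R_LL R_1LV.
  apply: denotes_ext (denotes_M (dT (inZ0_L _ _) (inZ0_L _ _))
    (denotes_M (denotes_iota Z0Z0_Rden) (dT (inZ0_1 _ _) (inZ0_LV _ _)))).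
  by by_coords.
rewrite (R_1_pow LLV_pow LVL_pow R_1LV).
apply: denotes_ext (denotes_M (dT (inZ0_1 _ _) (inZ0_L _ _)) denotes_RdenV).
by by_coords.
Qed.

Lemma pulled_back_E : pulled_back (E ^+ l).
Proof.
have [_ K2] := pulled_back_K.
have E1 : denotes (psi (E ^+ l \ox 1)) (fun _ w => phi (E ^+ l) w.2).
  rewrite R_E1; apply: denotes_ext (dT (inZ0_E _ _) (inZ0_L _ _)).
  by by_coords.
split=> //.
have -> : psi (1 \ox E ^+ l) = iota (K ^+ l \ox E ^+ l + E ^+ l \ox 1) -
    psi (E ^+ l \ox 1) * psi (1 \ox K ^+ l).
  by rewrite -psi_tens -R_DeltaE addrC addKr.
apply: denotes_ext (denotes_B (denotes_iota (Z0Z0_D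
  (Z0Z0_tens (inZ0_K _ _) (inZ0_E _ _)) (Z0Z0_tens (inZ0_E _ _) (inZ0_1 _ _))))
  (denotes_M E1 K2)).
by by_coords.
Qed.

Lemma pulled_back_F : pulled_back (F ^+ l).
Proof.
have [LV1 _] := pulled_back_LV.
have F2 : denotes (psi (1 \ox F ^+ l)) (fun _ w => phi (F ^+ l) w.1).
  rewrite R_1F; apply: denotes_ext (dT (inZ0_KV _ _) (inZ0_F _ _)).
  by by_coords.
split=> //.
have -> : psi (F ^+ l \ox 1) = iota (1 \ox F ^+ l + F ^+ l \ox LV ^+ l) -
    psi (LV ^+ l \ox 1) * psi (1 \ox F ^+ l).
  by rewrite -psi_tens -R_DeltaF addrK.
apply: denotes_ext (denotes_B (denotes_iota (Z0Z0_D
  (Z0Z0_tens (inZ0_1 _ _) (inZ0_F _ _)) (Z0Z0_tens (inZ0_F _ _) (inZ0_LV _ _))))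
  (denotes_M LV1 F2)).
by by_coords.
Qed.

Lemma pulled_back_1 : pulled_back 1.
Proof.
have d1 : denotes (psi (1 \ox 1)) (fun _ _ => 1).
  rewrite tens1 psi1 -(rmorph1 iota); exact: denotes_iota Z0Z0_1.
by split; apply: denotes_ext d1 => z w _; rewrite phi1.
Qed.

Lemma inZ0_pulled_back u : Z0 u -> pulled_back u.
Proof.
elim.
- exact: pulled_back_E.
- exact: pulled_back_F.
- exact: pulled_back_K.
- exact: pulled_back_KV.
- exact: pulled_back_L.
- exact: pulled_back_LV.
- exact: pulled_back_1.
- move=> k {}u Zu [u1 u2]; split.
    rewrite tensZl /psi [iota _]linearZ_LR [Rm _]linearZ_LR.
    by apply: denotes_ext (denotes_Z k u1) => z w _; rewrite (phi_Z phiP).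
  rewrite tensZr /psi [iota _]linearZ_LR [Rm _]linearZ_LR.
  by apply: denotes_ext (denotes_Z k u2) => z w _; rewrite (phi_Z phiP).
- move=> {}u v Zu [u1 u2] Zv [v1 v2]; split.
    rewrite tensDl psiD.
    by apply: denotes_ext (denotes_D u1 v1) => z w _; rewrite (phi_D phiP).
  rewrite tensDr psiD.
  by apply: denotes_ext (denotes_D u2 v2) => z w _; rewrite (phi_D phiP).
move=> {}u v Zu [u1 u2] Zv [v1 v2]; split.
  rewrite -[1]mulr1 tensM psiM.
  by apply: denotes_ext (denotes_M u1 v1) => z w _; rewrite (phi_M phiP).
rewrite -[1]mulr1 tensM psiM.
by apply: denotes_ext (denotes_M u2 v2) => z w _; rewrite (phi_M phiP).
Qed.

Lemma denotes_R t h : ZZ t h -> denotes (psi t) (fun _ w => h (w.2, w.1)).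
Proof.
move=> [s [Zs -> eh]].
apply: (@denotes_ext _ (fun _ w => \sum_(p <- s) phi p.1 w.2 * phi p.2 w.1)).
  by move=> z w _; rewrite eh.
elim: s Zs {eh} => [|p s IHs] Zs.
  rewrite big_nil -[0](scale0r 1) /psi [iota _]linearZ_LR [Rm _]linearZ_LR.
  have [d1 _] := pulled_back_1; rewrite tens1 in d1.
  by apply: denotes_ext (denotes_Z 0 d1) => z w _; rewrite big_nil mul0r.
rewrite big_cons psiD psi_tens.
have [Zp1 Zp2] := Zs p (mem_head _ _).
have [[p1 _] [_ p2]] := (inZ0_pulled_back Zp1, inZ0_pulled_back Zp2).
have /IHs ds : forall p, p \in s -> Z0 p.1 /\ Z0 p.2.
  by move=> i si; apply: Zs; rewrite inE si orbT.
apply: denotes_ext (denotes_D (denotes_M p1 p2) ds) => z w _.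
by rewrite big_cons.
Qed.

(** The denominator is non-zero in the tensor square, where its image is a unit
    of [D], and as a function, since it takes the value [1] at the identity. *)
Lemma R_pullback : is_pullback_of l phi iota Rm (@beta C).
Proof.
move=> t h /denotes_R[s [f [k [Zs es eh]]]].
exists f, (fun z => Rden_fun z ^+ k); split; last first.
  by move=> x y u v xy _; exact: (eh _ _ xy).
exists s, (Rden ^+ k); split=> //.
- exact: Z0Z0_X Z0Z0_Rden.
- have : iota (Rden ^+ k) \is a GRing.unit.
    by rewrite rmorphXn unitrX ?Rden_unit.
  by apply: contraTneq => ->; rewrite rmorph0 unitr0.
- have [x [ea _ ec _]] := @coords_surj C 1 0 0 1 (oner_neq0 _) (oner_neq0 _).
  exists (x, x); rewrite expf_neq0// /Rden_fun /pivot /= ea ec mul0r addr0.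
  by rewrite divr1 oner_neq0.
by rewrite rmorphXn.
Qed.

End RAutomorphism.

Theorem theorem4 (R : realType) (l : nat) (eps : R[i])
    (D : unitAlgType R[i]) (iota : {lrmorphism UU eps -> D})
    (Rm : {lrmorphism D -> D}) (phi : U eps -> GL2star R[i] -> R[i]) :
  odd l ->
  l.-primitive_root eps ->
  is_division_ring_of_fractions iota ->
  is_R_automorphism iota Rm ->
  is_Z0_identification l phi ->
  birational (@beta R[i]) /\ is_pullback_of l phi iota Rm (@beta R[i]).
Proof.
move=> lodd eps_prim fracD RmP phiP; split; last exact: R_pullback.
by split; [exact: beta_rational | exact: beta_inv_rational].
Qed.
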